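(* Let $X\sim\mathcal{MN}_{n\times p}(\mu,I_n,\Sigma)$ (independent rows $X_i\sim\mathcal{N}_p(\mu_i,\Sigma)$) with $\Sigma$ known positive definite, and run the randomized agglomerative clustering algorithm of the context on $X$. Fix $t$ and a possible realization $m=(m^{(1)},\dots,m^{(t)})$ of the first $t$ merges with $m^{(t)}=(C_1,C_2)$, define $\nu,U,\mathcal{A}_\Sigma$ and $X(u;\cdot)$ with respect to $(C_1,C_2)$, and suppose $H_0^{(t)}:\bar\mu_{C_1}=\bar\mu_{C_2}$ holds. Then for any value $\mathcal{A}_{\Sigma,o}$ of $\mathcal{A}_\Sigma$, the conditional distribution of $U$ given $\{\mathcal{A}_\Sigma=\mathcal{A}_{\Sigma,o},\ (M^{(1)},\dots,M^{(t)})=m\}$ has cumulative distribution function $$\mathbb{F}^{(t)}(u;\mathcal{A}_{\Sigma,o},m)=\frac{\int_0^u \ell_{\|\nu\|_2\chi_p}(u')\prod_{s=1}^t p^{(s)}\big(m^{(s)};X(u';\mathcal{A}_{\Sigma,o})\big)\,du'}{\int_0^\infty \ell_{\|\nu\|_2\chi_p}(u')\prod_{s=1}^t p^{(s)}\big(m^{(s)};X(u';\mathcal{A}_{\Sigma,o})\big)\,du'},$$ where $\ell_{\|\nu\|_2\chi_p}$ is the density of $\|\nu\|_2$ times a $\chi_p$ random variable.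
   Context: Randomized agglomerative clustering: start with singletons; at step $s$, $\mathcal{M}^{(s)}$ is the set of pairs of distinct current clusters, $d(M;x)\ge0$ a linkage dissimilarity; given $X=x$ the merge $M^{(s)}$ is drawn with probability $p^{(s)}(M;x)=\exp(-d(M;x)/\tau^{(s)})/\sum_{M'\in\mathcal{M}^{(s)}}\exp(-d(M';x)/\tau^{(s)})$, with $\tau^{(s)}=\tau\,|\mathcal{M}^{(s)}|^{-1}\sum_{M'\in\mathcal{M}^{(s)}}d(M';x)>0$, $\tau>0$ fixed; merged clusters are replaced by their union; draws independent across steps given data; $p^{(s)}(m^{(s)};x)$ uses the candidate set determined by $m^{(1)},\dots,m^{(s-1)}$. Test quantities: $\bar\mu_C=|C|^{-1}\sum_{i\in C}\mu_i$; $\nu_i=\mathbb{1}\{i\in C_1\}/|C_1|-\mathbb{1}\{i\in C_2\}/|C_2|$; $U=\|\Sigma^{-1/2}X^\top\nu\|_2$; $\mathcal{A}_\Sigma=(\xi,\pi)$ with $\xi=(\Sigma^{-1/2}X^\top\nu/\|\Sigma^{-1/2}X^\top\nu\|_2)^\top$ and $\pi=(I_n-\nu\nu^\top/\|\nu\|_2^2)X$; for $a=(\xi_a,\pi_a)$ and $u>0$, $X(u;a)=u\,\nu\,\xi_a\Sigma^{1/2}/\|\nu\|_2^2+\pi_a$. *)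

(* Defs.v *)
From HB Require Import structures.
From mathcomp Require Import all_boot all_order all_algebra.
From mathcomp Require Import all_classical all_reals all_analysis.
Set Implicit Arguments. Unset Strict Implicit. Unset Printing Implicit Defensive.
Import Order.TTheory GRing.Theory Num.Theory.

Local Open Scope ring_scope.

Section Defs.
Variable R : realType.

(* Lebesgue integration on R^k (for non-negative integrands), as an  *)
(* iterated one-dimensional Lebesgue integral (Tonelli).             *)
Fixpoint iint (k : nat) : (k.-tuple R -> \bar R) -> \bar R :=
  match k return (k.-tuple R -> \bar R) -> \bar R with
  | 0 => fun f => f [tuple]
  | k'.+1 => fun f =>
      (\int[@lebesgue_measure R]_x iint (fun t : k'.-tuple R => f (cons_tuple x t)))%E
  end.

Variables n p : nat.

Definition tup2mx (t : (n * p).-tuple R) : 'M[R]_(n, p) :=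
  \matrix_(i < n, j < p) tnth t (mxvec_index i j).

Definition intX (f : 'M[R]_(n, p) -> \bar R) : \bar R :=
  iint (fun t => f (tup2mx t)).

Definition mx_measurable (E : set 'M[R]_(n, p)) : Prop :=
  measurable (preimage tup2mx E).
Definition mx_measurable_fun (f : 'M[R]_(n, p) -> R) : Prop :=
  measurable_fun setT (f \o tup2mx).

Definition mn_density (mu : 'M[R]_(n, p)) (Sigma : 'M[R]_p) (x : 'M[R]_(n, p)) : R :=
  expR (- (\tr ((x - mu) *m invmx Sigma *m (x - mu)^T)) / 2) /
  (Num.sqrt ((2 * pi) ^+ (n * p)) * Num.sqrt (\det Sigma ^+ n)).

(* Randomized agglomerative clustering.
   A cluster is a {set 'I_n}; a clustering is a {set {set 'I_n}};
   a merge (an unordered pair of distinct clusters) is a {set {set 'I_n}}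
   with two elements. *)
Definition init_clusters : {set {set 'I_n}} := [set [set i] | i : 'I_n].

Definition merge_step (cl : {set {set 'I_n}}) (M : {set {set 'I_n}}) :=
  (cl :\: M) :|: [set finset.cover M].

Definition clusters_after (ms : seq {set {set 'I_n}}) :=
  foldl merge_step init_clusters ms.

Definition candidates (cl : {set {set 'I_n}}) : {set {set {set 'I_n}}} :=
  [set [set C; C'] | C in cl, C' in cl & C != C'].

(* linkage dissimilarity d(M; x) and base temperature tau *)
Variable d : {set {set 'I_n}} -> 'M[R]_(n, p) -> R.
Variable tau : R.

Definition temp (cl : {set {set 'I_n}}) (x : 'M[R]_(n, p)) : R :=
  tau * ((#|candidates cl|%:R)^-1 * \sum_(M' in candidates cl) d M' x).

Definition merge_prob (cl : {set {set 'I_n}}) (M : {set {set 'I_n}})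
    (x : 'M[R]_(n, p)) : R :=
  if M \in candidates cl then
    expR (- d M x / temp cl x) /
    \sum_(M' in candidates cl) expR (- d M' x / temp cl x)
  else 0.

Definition path_prob (ms : seq {set {set 'I_n}}) (x : 'M[R]_(n, p)) : R :=
  \prod_(s < size ms) merge_prob (clusters_after (take s ms)) (nth (@finset.set0 _) ms s) x.

Definition valid_merges (ms : seq {set {set 'I_n}}) : Prop :=
  forall s, (s < size ms)%N ->
    nth (@finset.set0 _) ms s \in candidates (clusters_after (take s ms)).

Definition clmean (mu : 'M[R]_(n, p)) (C : {set 'I_n}) : 'rV[R]_p :=
  (#|C|%:R)^-1 *: \sum_(i in C) row i mu.

Definition nuvec (C1 C2 : {set 'I_n}) : 'cV[R]_n :=
  \col_i ((i \in C1)%:R / #|C1|%:R - (i \in C2)%:R / #|C2|%:R).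

Definition vnorm (k : nat) (v : 'cV[R]_k) : R := Num.sqrt (\sum_i v i 0 ^+ 2).

(* Sh plays the role of Sigma^{1/2}; invmx Sh = Sigma^{-1/2} *)
Definition wvec (Sh : 'M[R]_p) (C1 C2 : {set 'I_n}) (x : 'M[R]_(n, p)) : 'cV[R]_p :=
  invmx Sh *m x^T *m nuvec C1 C2.

Definition Ustat Sh C1 C2 x : R := vnorm (wvec Sh C1 C2 x).

Definition Astat Sh C1 C2 (x : 'M[R]_(n, p)) : 'rV[R]_p * 'M[R]_(n, p) :=
  (((vnorm (wvec Sh C1 C2 x))^-1 *: wvec Sh C1 C2 x)^T,
   (1%:M - (vnorm (nuvec C1 C2) ^+ 2)^-1 *: (nuvec C1 C2 *m (nuvec C1 C2)^T)) *m x).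

Definition Xu Sh C1 C2 (u : R) (a : 'rV[R]_p * 'M[R]_(n, p)) : 'M[R]_(n, p) :=
  (u / vnorm (nuvec C1 C2) ^+ 2) *: (nuvec C1 C2 *m a.1 *m Sh) + a.2.

Definition chi_kernel (x : R) : R := x ^+ (p.-1) * expR (- (x ^+ 2) / 2).
Definition chi_const : R :=
  fine (\int[@lebesgue_measure R]_(y in `[0%R, +oo[) (chi_kernel y)%:E)%E.
Definition chi_density (x : R) : R := if 0 <= x then chi_kernel x / chi_const else 0.
Definition scaled_chi_density (c u : R) : R := c^-1 * chi_density (u / c).

Definition Fcdf Sh C1 C2 (ms : seq {set {set 'I_n}}) (u : R)
    (a : 'rV[R]_p * 'M[R]_(n, p)) : R :=
  let g := fun v => (scaled_chi_density (vnorm (nuvec C1 C2)) v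
                     * path_prob ms (Xu Sh C1 C2 v a))%:E in
  fine (\int[@lebesgue_measure R]_(v in `[0%R, u]) g v)%E /
  fine (\int[@lebesgue_measure R]_(v in `[0%R, +oo[) g v)%E.

End Defs.

(* Main.v *)
(** Let [dil nu s] multiply by [s] the component along [nu] of every column of a
matrix.  It multiplies [U] by [s], fixes [A_Sigma], and moves [x] along the ray
[v |-> X(v; A_Sigma x)], while [intX (H o dil nu s) = s^-p intX H].  Inserting the
scale-invariant measure [ds / s] restricted to a window on [U / s] and exchanging
the integrals (Tonelli), one sees that, up to the event [U = 0], [intX H] depends
only on the integrals [int_0^oo v^(p-1) H(X(v; A_Sigma x)) dv].  Under [H_0] the
orthogonality of [nu] to the mean makes the Gaussian density along a ray
proportional to [exp (- v^2 / (2 |nu|^2))], so [v^(p-1)] times it is proportional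
to the density of [|nu| chi_p].  Hence the integrands
[density * path_prob * 1_B(A_Sigma) * 1_(U <= u)] and
[density * path_prob * 1_B(A_Sigma) * F(u; A_Sigma)] have the same ray integrals.
The event [U = 0] is negligible because the dilations fix it pointwise. *)

Require Import Defs.
From HB Require Import structures.
From mathcomp Require Import all_boot all_order all_algebra.
From mathcomp Require Import all_classical all_reals all_analysis.
From mathcomp Require Import measurable_realfun ring lra.
Import Order.TTheory GRing.Theory Num.Theory.
Local Open Scope classical_set_scope.
Local Open Scope ring_scope.
Set Implicit Arguments. Unset Strict Implicit. Unset Printing Implicit Defensive.

(** * Iterated Lebesgue integrals as integrals against one sigma-finite measure *)

Section IteratedLebesgue.
Context {R : realType}.
Local Open Scope ereal_scope.
Local Notation leb := (@lebesgue_measure R).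

(** [intX] is an iterated one-dimensional integral, so the Jacobian [s^p] of a dilation has to come
    from one-dimensional affine substitutions. The dilation is therefore factored into shears, each
    of which rescales some rows and adds to them multiples of rows that it leaves alone. The window
    on [U / s] is there because [ds / s] has infinite mass on the half-line: restricted to
    [1 <= U / s <= 2] its mass is finite, positive and, by scale invariance, the same for every
    [U > 0], so it can be cancelled. The law of [(X, M)] is given only on events, while the
    conclusion integrates a function of [X]; a layer-cake formula reduces that integral to
    probabilities of level sets. *)

Lemma ge0_integral_affine (a b : R) (h : R -> \bar R) :
  (0 < a)%R -> measurable_fun setT h -> (forall x, 0 <= h x) ->
  \int[leb]_x h x = a%:E * \int[leb]_x h (a * x + b)%R.
Proof.
move=> a0 mh h0.
pose phi : measurableTypeR R -> measurableTypeR R := fun x => (a * x + b)%R.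
have mphi : measurable_fun setT phi.
  by apply: measurable_funD => //; apply: measurable_funM.
pose k : {nonneg R} := NngNum (ltW a0).
pose fi := isMeasurableFun.Build _ _ _ _ phi mphi.
pose phiM : {mfun _ >-> _} := HB.pack phi fi.
(* The pushforward scaled by [a] agrees with Lebesgue measure on half-open intervals, hence on all
   measurable sets. *)
rewrite (eq_measure_integral (mscale k (pushforward leb phiM))); last first.
  move=> A mA _; apply: lebesgue_measure_unique => //= _ [[x y] _ <-].
  rewrite /mscale/= /pushforward.
  have -> : phi @^-1` [set` `]x, y]] = [set` `](x - b) / a, (y - b) / a]]%R.
    apply/seteqP; split => z /=; rewrite !in_itv/= /phi;
    by rewrite ltr_pdivrMr// ler_pdivlMr// lterBDr mulrC lerBrDr.
  rewrite !lebesgue_measure_itv/= !lte_fin ltr_pM2r ?invr_gt0// ltrD2r.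
  case: ifP => xy; last by rewrite mule0.
  rewrite -!EFinB -EFinM; congr EFin.
  by rewrite -mulrBl mulrCA mulfV ?gt_eqF// mulr1 opprB addrA subrK.
rewrite ge0_integral_mscale//=; congr (_ * _); rewrite ge0_integral_pushforward//.
Qed.

Lemma sigma_finite_pushforward_prod d1 d2 d3 (T1 : measurableType d1)
    (T2 : measurableType d2) (T3 : measurableType d3)
    (m1 : {sigma_finite_measure set T1 -> \bar R})
    (m2 : {sigma_finite_measure set T2 -> \bar R})
    (c : T1 * T2 -> T3) (c' : T3 -> T1 * T2) :
  measurable_fun setT c' -> cancel c c' ->
  sigma_finite setT (pushforward (m1 \x m2) c).
Proof.
move=> mc' cK.
have /sigma_finiteP[F [TF ndF Foo]] := sigma_finiteT m1.
have /sigma_finiteP[G [TG ndG Goo]] := sigma_finiteT m2.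
exists (fun n => c' @^-1` (F n `*` G n)).
  rewrite -preimage_bigcup; apply/seteqP; split => // z _ /=.
  have : [set: T1] (c' z).1 by [].
  have : [set: T2] (c' z).2 by [].
  rewrite TF TG => -[j _ Gj] [i _ Fi]; exists (maxn i j) => //; split.
    by move: Fi; apply/subsetPset/ndF/leq_maxl.
  by move: Gj; apply/subsetPset/ndG/leq_maxr.
move=> k; have [mF Fk] := Foo k; have [mG Gk] := Goo k; split.
  rewrite -[X in measurable X]setTI; apply: mc' => //.
  exact: measurableX.
rewrite /pushforward -comp_preimage (_ : c' \o c = id) ?preimage_id; last first.
  by apply/funext => x /=; rewrite cK.
by rewrite product_measure1E// lte_mul_pinfty// ge0_fin_numE.
Qed.

Lemma iterated_integral_measure d1 d2 d3 (T1 : measurableType d1)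
    (T2 : measurableType d2) (T3 : measurableType d3)
    (m1 : {sigma_finite_measure set T1 -> \bar R})
    (m2 : {sigma_finite_measure set T2 -> \bar R})
    (c : T1 * T2 -> T3) (c' : T3 -> T1 * T2) :
  measurable_fun setT c -> measurable_fun setT c' -> cancel c c' ->
  exists m3 : {sigma_finite_measure set T3 -> \bar R},
  forall h, measurable_fun setT h -> (forall x, 0 <= h x) ->
  \int[m3]_z h z = \int[m1]_x \int[m2]_y h (c (x, y)).
Proof.
move=> mc mc' cK.
pose pm : {measure set T3 -> \bar R} :=
  measure_function_pushforward__canonical__measure_function_Measure (m1 \x m2) mc.
pose sf := Measure_isSigmaFinite.Build _ _ _ pm
  (sigma_finite_pushforward_prod m1 m2 mc' cK).
pose m3 : {sigma_finite_measure set T3 -> \bar R} := HB.pack (pm : set T3 -> \bar R) pm sf.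
exists m3 => h mh h0.
rewrite ge0_integral_pushforward//= preimage_setT fubini_tonelli1//.
exact: measurableT_comp.
Qed.

(** Makes Tonelli, additivity and monotonicity available for [iint]. The witness is a Dirac mass for
    [k = 0], then the image under [cons_tuple] of a product measure; sigma-finiteness is kept
    because the next product requires it. *)
Lemma iint_measure k : exists m : {sigma_finite_measure set k.-tuple R -> \bar R},
  forall f : k.-tuple R -> \bar R, measurable_fun setT f -> (forall t, 0 <= f t) ->
  iint f = \int[m]_t f t.
Proof.
elim: k => [|k [m IH]].
  exists (\d_([tuple] : 0.-tuple R)) => f mf f0 /=.
  by rewrite integral_dirac// diracT mul1e.
have mc : measurable_fun setT
    (fun xt : measurableTypeR R * k.-tuple R => cons_tuple (xt.1 : R) xt.2 : k.+1.-tuple R).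
  exact: measurable_cons.
have mc' : measurable_fun setT (fun t : k.+1.-tuple R =>
    (thead t, [tuple of behead t]) : measurableTypeR R * k.-tuple R).
  apply/measurable_fun_pairP; split; last exact: measurable_behead.
  exact: measurable_tnth.
have [|m3 m3E] := iterated_integral_measure leb m mc mc'.
  by move=> [x t] /=; congr pair; apply/val_inj.
exists m3 => f mf f0 /=.
rewrite m3E//; apply: eq_integral => x _; rewrite IH//.
by apply: measurableT_comp => //; exact: measurable_cons.
Qed.

End IteratedLebesgue.

(** * Change of variables for shears of tuples *)

Section Shear.
Context {R : realType}.
Local Open Scope ereal_scope.
Local Notation leb := (@lebesgue_measure R).

Definition shear k (J : pred 'I_k) (a : R) (g : 'I_k -> k.-tuple R -> R)
    (t : k.-tuple R) : k.-tuple R :=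
  [tuple if J c then (a * tnth t c + g c t)%R else tnth t c | c < k].

Lemma measurable_shear k (J : pred 'I_k) a (g : 'I_k -> k.-tuple R -> R) :
  (forall c, measurable_fun setT (g c)) -> measurable_fun setT (shear J a g).
Proof.
move=> mg; apply/measurable_fun_tnthP => c.
rewrite (_ : _ \o _ = fun t => if J c then (a * tnth t c + g c t)%R else tnth t c);
  last by apply/funext => t /=; rewrite tnth_mktuple.
case: (J c); last exact: measurable_tnth.
by apply: measurable_funD => //; apply: measurable_funM => //; exact: measurable_tnth.
Qed.

Lemma shear_cons k (J : pred 'I_k.+1) a (g : 'I_k.+1 -> k.+1.-tuple R -> R) x
    (t : k.-tuple R) :
  shear J a g (cons_tuple x t) =
  cons_tuple (if J ord0 then a * x + g ord0 (cons_tuple x t) else x)%R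
    (shear (fun c => J (lift ord0 c)) a
       (fun c t => g (lift ord0 c) (cons_tuple x t)) t).
Proof.
apply: eq_from_tnth => c; rewrite tnth_mktuple.
case: (unliftP ord0 c) => [c' ->|->]; last by rewrite !tnth0.
by rewrite !tnthS tnth_mktuple.
Qed.

Lemma measurable_cons_tuple k d (T : measurableType d) (x : T -> R)
    (t : T -> k.-tuple R) : measurable_fun setT x -> measurable_fun setT t ->
  measurable_fun setT (fun w => cons_tuple (x w) (t w)).
Proof. by move=> mx mt; exact: measurable_cons. Qed.

(** Induction on the coordinates. A head outside [J] is a fixed parameter of the shear of the tail.
    A head inside [J] is invisible to every [g c], so it can be integrated innermost, where its
    substitution is affine in one variable. *)
Lemma iint_shear k (J : pred 'I_k) a (g : 'I_k -> k.-tuple R -> R)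
    (H : k.-tuple R -> \bar R) :
  (0 < a)%R -> (forall c, measurable_fun setT (g c)) ->
  (forall c t t', (forall c', ~~ J c' -> tnth t c' = tnth t' c') -> g c t = g c t') ->
  measurable_fun setT H -> (forall t, 0 <= H t) ->
  iint H = (a ^+ (\sum_(c < k) J c))%:E * iint (fun t => H (shear J a g t)).
Proof.
move=> a0; elim: k => [|k IH] in J g H *.
  move=> mg gJ mH H0; rewrite big_ord0 expr0 mul1e /=; congr H.
  by rewrite [RHS]tuple0.
move=> mg gJ mH H0; have [m mE] := @iint_measure R k.
have mcons (x : R) : measurable_fun setT (fun t : k.-tuple R => cons_tuple x t).
  exact: measurable_cons.
have mcons2 : measurable_fun setT
    (fun xt : measurableTypeR R * k.-tuple R => cons_tuple (xt.1 : R) xt.2 : k.+1.-tuple R).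
  exact: measurable_cons.
pose J' c := J (lift ord0 c).
pose S x := shear J' a (fun c t => g (lift ord0 c) (cons_tuple x t)).
have mS x : measurable_fun setT (S x).
  by apply: measurable_shear => c; exact: measurableT_comp.
have mQ : measurable_fun setT (fun xt : measurableTypeR R * k.-tuple R =>
    H (shear J a g (cons_tuple (xt.1 : R) xt.2))).
  by do 2 (apply: measurableT_comp => //); exact: measurable_shear.
have IHx x : iint (fun t => H (cons_tuple x t)) =
    (a ^+ (\sum_(c < k) J' c))%:E * iint (fun t => H (cons_tuple x (S x t))).
  apply: (IH J' _ (fun t => H (cons_tuple x t))) => //.
  - by move=> c; exact: measurableT_comp.
  - move=> c t t' tt'; apply: gJ => c'.
    case: (unliftP ord0 c') => [c'' ->|->]; last by rewrite !tnth0.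
    by rewrite !tnthS; exact: tt'.
  - exact: measurableT_comp.
have iintQ x : iint (fun t => H (shear J a g (cons_tuple x t))) =
    \int[m]_t H (shear J a g (cons_tuple x t)).
  by rewrite mE//; do 2 (apply: measurableT_comp => //); exact: measurable_shear.
have mF : measurable_fun setT (fun x : measurableTypeR R =>
    iint (fun t => H (shear J a g (cons_tuple (x : R) t)))).
  under eq_fun do rewrite iintQ.
  by apply: (measurable_fun_fubini_tonelli_F
    (fun xt => H (shear J a g (cons_tuple (xt.1 : R) xt.2)))).
have F0 (x : R) : 0 <= iint (fun t => H (shear J a g (cons_tuple x t))).
  by rewrite iintQ; exact: integral_ge0.
rewrite big_ord_recl exprD /=.
case J0 : (J ord0); last first.
  rewrite expr0 mul1r -ge0_integralZl//; last by rewrite lee_fin exprn_ge0// ltW.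
  apply: eq_integral => x _; rewrite IHx; congr (_ * iint _).
  by apply/funext => t; rewrite shear_cons J0.
have gx c x t : g c (cons_tuple x t) = g c (cons_tuple 0%R t).
  apply: gJ => c'; case: (unliftP ord0 c') => [c'' ->|->]; first by rewrite !tnthS.
  by rewrite J0.
have SE x : S x = S 0%R.
  by apply/funext => t; rewrite /S; congr tval; apply: eq_from_tnth => c;
    rewrite !tnth_mktuple gx.
have mP : measurable_fun setT (fun xt : measurableTypeR R * k.-tuple R =>
    H (cons_tuple (xt.1 : R) (S 0%R xt.2))).
  apply: measurableT_comp => //; apply: measurable_cons_tuple => //.
  exact: measurableT_comp.
transitivity ((a ^+ (\sum_(c < k) J' c))%:E *
    \int[leb]_x \int[m]_t H (cons_tuple x (S 0%R t))).
  rewrite -ge0_integralZl//; last 3 first.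
  - by apply: (measurable_fun_fubini_tonelli_F
      (fun xt => H (cons_tuple (xt.1 : R) (S 0%R xt.2)))).
  - by move=> x _; exact: integral_ge0.
  - by rewrite lee_fin exprn_ge0// ltW.
  apply: eq_integral => x _; rewrite IHx SE; congr (_ * _); rewrite mE//.
  by do 2 (apply: measurableT_comp => //).
rewrite mulrC EFinM -muleA expr1; congr (_ * _).
(* With the tail [t] fixed, the head undergoes [x := a * x + g ord0 t], whose translation no longer
   depends on [x]. *)
have /= -> := fubini_tonelli (m1 := leb) (m2 := m) _ mP (fun=> H0 _).
under [in RHS]eq_integral do rewrite iintQ.
have /= -> := fubini_tonelli (m1 := leb) (m2 := m) _ mQ (fun=> H0 _).
rewrite -ge0_integralZl//; last 3 first.
- exact: (measurable_fun_fubini_tonelli_G (m1 := leb) _ mQ (fun=> H0 _)).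
- by move=> x _; exact: integral_ge0.
- by rewrite lee_fin ltW.
apply: eq_integral => t _.
rewrite (ge0_integral_affine (g ord0 (cons_tuple 0%R t)) a0)//; last first.
  by apply: measurableT_comp => //; exact: measurable_cons.
congr (_ * _); apply: eq_integral => x _.
by rewrite shear_cons J0 gx -(SE x).
Qed.

End Shear.

(** * Measurability of matrix-valued maps, entry by entry *)

Section MatrixMeasurability.
Context {R : realType}.

Definition mx2tup n p (x : 'M[R]_(n, p)) : (n * p).-tuple R :=
  [tuple mxvec x ord0 c | c < n * p].

Lemma mx2tupK n p : cancel (@mx2tup n p) (@tup2mx R n p).
Proof. by move=> x; apply/matrixP => i j; rewrite mxE tnth_mktuple mxvecE. Qed.

Definition measurable_mx d (T : measurableType d) n p (g : T -> 'M[R]_(n, p)) :=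
  forall i j, measurable_fun setT (fun t => g t i j).

Section Closure.
Context d (T : measurableType d).

Lemma measurable_mx_tup n p (g : T -> 'M[R]_(n, p)) :
  measurable_mx g -> measurable_fun setT (fun t => mx2tup (g t)).
Proof.
move=> mg; apply/measurable_fun_tnthP => c.
case/mxvec_indexP: c => i j.
by rewrite (_ : _ \o _ = fun t => g t i j)//; apply/funext => t /=;
  rewrite tnth_mktuple mxvecE.
Qed.

(** Measurability of a function of a matrix is only expressed after composition with [tup2mx], so
    [g] is routed through tuples by [mx2tupK]. *)
Lemma measurable_mx_comp n p d' (T' : measurableType d') (f : 'M[R]_(n, p) -> T')
    (g : T -> 'M[R]_(n, p)) :
  measurable_fun setT (fun t => f (tup2mx t)) -> measurable_mx g ->
  measurable_fun setT (fun t => f (g t)).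
Proof.
move=> mf mg.
rewrite (_ : (fun _ => _) = (fun t => f (tup2mx t)) \o (fun t => mx2tup (g t))).
  by apply: measurableT_comp => //; exact: measurable_mx_tup.
by apply/funext => t /=; rewrite mx2tupK.
Qed.

Lemma measurable_mx_cst n p (A : 'M[R]_(n, p)) : measurable_mx (fun _ : T => A).
Proof. by move=> i j; exact: measurable_cst. Qed.

Lemma measurable_mxD n p (f g : T -> 'M[R]_(n, p)) :
  measurable_mx f -> measurable_mx g -> measurable_mx (fun t => f t + g t).
Proof.
by move=> mf mg i j; under eq_fun do rewrite mxE; exact: measurable_funD.
Qed.

Lemma measurable_mxZ n p (a : T -> R) (f : T -> 'M[R]_(n, p)) :
  measurable_fun setT a -> measurable_mx f -> measurable_mx (fun t => a t *: f t).
Proof.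
by move=> ma mf i j; under eq_fun do rewrite mxE; exact: measurable_funM.
Qed.

Lemma measurable_mxM n p q (f : T -> 'M[R]_(n, p)) (g : T -> 'M[R]_(p, q)) :
  measurable_mx f -> measurable_mx g -> measurable_mx (fun t => f t *m g t).
Proof.
move=> mf mg i j; under eq_fun do rewrite mxE.
by apply: measurable_sum => k; exact: measurable_funM.
Qed.

Lemma measurable_mxT n p (f : T -> 'M[R]_(n, p)) :
  measurable_mx f -> measurable_mx (fun t => (f t)^T).
Proof. by move=> mf i j; under eq_fun do rewrite mxE; exact: mf. Qed.

End Closure.

Lemma measurable_mx_tup2mx n p : measurable_mx (@tup2mx R n p).
Proof. by move=> i j; under eq_fun do rewrite mxE; exact: measurable_tnth. Qed.

End MatrixMeasurability.

(** * Dilations along a vector and their Jacobian *)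

Section Dilation.
Context {R : realType}.

Definition rowshear n p (I : pred 'I_n) (a : R) (B : 'M[R]_n) (x : 'M[R]_(n, p)) :
    'M[R]_(n, p) :=
  \matrix_(i, j) if I i then a * x i j + \sum_(k | ~~ I k) B i k * x k j else x i j.

(** Rows outside [I] are fixed and are the only ones added to the rows of [I]; on tuples this is a
    [shear] of the [#|I| * p] entries of those rows. *)
Lemma intX_rowshear n p (I : pred 'I_n) (a : R) (B : 'M[R]_n)
    (H : 'M[R]_(n, p) -> \bar R) :
  0 < a -> measurable_fun setT (fun t => H (tup2mx t)) -> (forall x, 0 <= H x)%E ->
  intX H = ((a ^+ (#|I| * p))%:E * intX (fun x => H (rowshear I a B x)))%E.
Proof.
move=> a0 mH H0; rewrite /intX.
pose idx (c : 'I_(n * p)) := enum_val (cast_ord (esym (mxvec_cast n p)) c).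
have idxE i j : idx (mxvec_index i j) = (i, j).
  by rewrite /idx /mxvec_index cast_ordK enum_rankK.
pose J c := I (idx c).1.
pose g c (t : (n * p).-tuple R) :=
  \sum_(k | ~~ I k) B (idx c).1 k * tnth t (mxvec_index k (idx c).2).
rewrite (@iint_shear _ _ J a g)//.
- congr (_ * _)%E.
    congr (_ ^+ _)%:E; rewrite (reindex _ (curry_mxvec_bij n p))/=.
    rewrite (eq_bigr (fun ij : 'I_n * 'I_p => I ij.1 : nat)); last first.
      by move=> [i j] _; rewrite /J idxE.
    rewrite -(pair_big predT predT (fun i (j : 'I_p) => I i : nat))/=.
    rewrite -sum1_card big_distrl/= [RHS]big_mkcond/=; apply: eq_bigr => i _.
    rewrite sum_nat_const card_ord -topredE/=.
    by case: (I i); rewrite ?muln1 ?mul1n ?muln0.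
  congr iint; apply/funext => t; congr H; apply/matrixP => i j.
  rewrite !mxE tnth_mktuple /J /g idxE /=; case: (I i) => //.
  by congr (_ + _); apply: eq_bigr => k _; rewrite mxE.
- move=> c; rewrite /g; under eq_fun do rewrite big_mkcond.
  apply: measurable_sum => k; case: (~~ I k) => //.
  by apply: measurable_funM => //; exact: measurable_tnth.
- move=> c t t' tt'; apply: eq_bigr => k Ik; congr (_ * _); apply: tt'.
  by rewrite /J idxE.
Qed.

Lemma measurable_rowshear d (T : measurableType d) n p (I : pred 'I_n) (a : R)
    (B : 'M[R]_n) (g : T -> 'M[R]_(n, p)) :
  measurable_mx g -> measurable_mx (fun t => rowshear I a B (g t)).
Proof.
move=> mg i j; under eq_fun do rewrite mxE.
case: (I i); last exact: mg.
apply: measurable_funD; first exact: measurable_funM.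
under eq_fun do rewrite big_mkcond.
by apply: measurable_sum => k; case: (~~ I k) => //; exact: measurable_funM.
Qed.

Definition sqnorm n (nu : 'cV[R]_n) := \sum_i nu i 0 ^+ 2.

Definition dil n p (nu : 'cV[R]_n) (s : R) (x : 'M[R]_(n, p)) : 'M[R]_(n, p) :=
  x + ((s - 1) / sqnorm nu) *: (nu *m (nu^T *m x)).

(* LU-type factorisation of the rank-one perturbation [1 + c nu nu^T], pivoting
   on a non-zero entry of [nu]. *)
Lemma dil_rowshear n p (nu : 'cV[R]_n) (s : R) (i0 : 'I_n) (x : 'M[R]_(n, p)) :
  nu i0 0 != 0 ->
  dil nu s x =
  rowshear (pred1 i0) s (\matrix_(i, k) - (nu k 0 / nu i0 0))
   (rowshear (predC1 i0) 1
      (\matrix_(i, k) ((s - 1) / sqnorm nu * nu i0 0 * nu i 0))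
    (rowshear (pred1 i0) 1 (\matrix_(i, k) (nu k 0 / nu i0 0)) x)).
Proof.
move=> c0; set N := sqnorm nu; set c := nu i0 0 in c0 *.
have N0 : N != 0.
  rewrite gt_eqF// /N /sqnorm (bigD1 i0)//=; apply: ltr_pwDl.
    by rewrite exprn_even_gt0//= c0.
  by apply: sumr_ge0 => i _; exact: sqr_ge0.
apply/matrixP => i j.
set y := rowshear _ 1 _ x; set z := rowshear _ 1 _ y.
pose w := \sum_k nu k 0 * x k j.
have wE : (nu *m (nu^T *m x)) i j = nu i 0 * w.
  by rewrite mxE big_ord1 mxE; congr (_ * _); apply: eq_bigr => k _; rewrite mxE.
have y0 : y i0 j = w / c.
  rewrite mxE /= eqxx mul1r /w [in RHS](bigD1 i0)//= mulrDl [c * _]mulrC mulfK//.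
  by congr (_ + _); rewrite big_distrl/=; apply: eq_bigr => k _;
    rewrite mxE mulrAC.
have z0 : z i0 j = w / c by rewrite mxE /= eqxx/=.
have zE k : k != i0 -> z k j = x k j + (s - 1) / N * nu k 0 * w.
  move=> ki0; rewrite mxE /= ki0 mul1r; congr (_ + _).
    by rewrite mxE/= (negbTE ki0).
  rewrite (big_pred1 i0); last by move=> k' /=; rewrite negbK.
  by rewrite mxE y0 -/c; field; rewrite ?N0 ?c0.
rewrite [LHS]mxE [X in _ + X]mxE wE mxE /=; case: ifPn => [/eqP ->|ii0]; last first.
  by rewrite zE// mulrA.
rewrite z0.
rewrite (eq_bigr (fun k => - (c^-1 * (nu k 0 * x k j)) -
    (s - 1) / N * w / c * nu k 0 ^+ 2)); last first.
  by move=> k ki0; rewrite mxE zE//; field; rewrite ?N0 ?c0.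
rewrite big_split/= !sumrN -!mulr_sumr.
have -> : \sum_(k | k != i0) nu k 0 * x k j = w - c * x i0 j.
  by rewrite /w [in RHS](bigD1 i0)//= -/c [c * _ + _]addrC addrK.
have -> : \sum_(k | k != i0) nu k 0 ^+ 2 = N - c ^+ 2.
  by rewrite /N /sqnorm [in RHS](bigD1 i0)//= -/c [c ^+ 2 + _]addrC addrK.
by rewrite -/N -/c; field; rewrite ?N0 ?c0.
Qed.

(** In the factorisation only the pivot row, with its [p] entries, is scaled by [s]; the other two
    factors have Jacobian 1. *)
Lemma intX_dil n p (nu : 'cV[R]_n) (s : R) (H : 'M[R]_(n, p) -> \bar R) :
  nu != 0 -> 0 < s ->
  measurable_fun setT (fun t => H (tup2mx t)) -> (forall x, 0 <= H x)%E ->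
  intX H = ((s ^+ p)%:E * intX (fun x => H (dil nu s x)))%E.
Proof.
move=> nu0 s0 mH H0.
have [i0 ni0] : exists i0, nu i0 0 != 0.
  apply/existsP; apply: contraNT nu0; rewrite negb_exists => /forallP nu0.
  apply/eqP/matrixP => i j; rewrite ord1 mxE; apply/eqP.
  by have := nu0 i; rewrite negbK.
under [in RHS]eq_fun do rewrite (dil_rowshear s _ ni0).
have mr I a B (G : 'M[R]_(n, p) -> \bar R) :
    measurable_fun setT (fun t => G (tup2mx t)) ->
    measurable_fun setT (fun t => G (rowshear I a B (tup2mx t))).
  move=> mG; apply: (measurable_mx_comp (f := G)) => //.
  by apply: measurable_rowshear; exact: measurable_mx_tup2mx.
rewrite (intX_rowshear (pred1 i0) (\matrix_(i, k) - (nu k 0 / nu i0 0)) s0)//.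
rewrite card1 mul1n; congr (_ * _)%E.
rewrite (intX_rowshear (predC1 i0) (\matrix_(i, k)
  ((s - 1) / sqnorm nu * nu i0 0 * nu i 0)) (@ltr01 R))//; last exact: mr.
rewrite expr1n mul1e.
rewrite (intX_rowshear (pred1 i0) (\matrix_(i, k) (nu k 0 / nu i0 0)) (@ltr01 R))//.
  by rewrite expr1n mul1e.
apply: (measurable_mx_comp (f := H)) => //.
by do 2 (apply: measurable_rowshear); exact: measurable_mx_tup2mx.
Qed.

End Dilation.

(** * Measurability of inverses, quotients and square roots *)

Section RealMeasurability.
Context {R : realType} d (T : measurableType d).

Lemma measurable_funV (f : T -> R) :
  measurable_fun setT f -> measurable_fun setT (fun t => (f t)^-1).
Proof.
(* Squaring makes the base of the real power nonnegative; where [f t = 0] the outer factor gives 0,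
   in accordance with [0^-1 = 0]. *)
move=> mf; rewrite (_ : (fun t => _) = fun t => f t * (f t ^+ 2) `^ (-1)).
  apply: measurable_funM => //.
  apply: (measurableT_comp (measurable_powR _)); exact: measurable_funX.
apply/funext => t; rewrite powR_inv1 ?sqr_ge0//.
have [->|ft0] := eqVneq (f t) 0; first by rewrite mul0r invr0.
by rewrite expr2 invfM mulrA mulfV// mul1r.
Qed.

Lemma measurable_fun_div (f g : T -> R) :
  measurable_fun setT f -> measurable_fun setT g ->
  measurable_fun setT (fun t => f t / g t).
Proof. by move=> mf mg; apply: measurable_funM => //; exact: measurable_funV. Qed.

Lemma measurable_fun_sqrt (f : T -> R) :
  measurable_fun setT f -> measurable_fun setT (fun t => Num.sqrt (f t)).
Proof.
move=> mf; have ms : measurable_fun setT (fun x : R => Num.sqrt x).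
  by apply: continuous_measurable_fun; exact: sqrt_continuous.
exact: measurableT_comp ms mf.
Qed.

End RealMeasurability.

(** * Integrals over matrix space compared through integrals along dilation orbits *)

Section RadialComparison.
Context {R : realType}.
Local Open Scope ereal_scope.
Local Notation leb := (@lebesgue_measure R).
Local Notation pos := (\1_(`]0%R, +oo[%classic : set R) : R -> R).
Local Notation win := (\1_(`[1%R, 2%R]%classic : set R) : R -> R).

(** The mass of [ds / s] on [1/2 <= s <= 1], that is [ln 2]; what matters is that it is positive and
    finite. *)
Definition radial_mass : \bar R := \int[leb]_s (s^-1 * pos s * win s^-1)%:E.

Lemma posE (x : R) : pos x = (0 < x)%R%:R.
Proof.
by rewrite indicE; congr ((nat_of_bool _)%:R); apply/idP/idP;
  rewrite inE /= in_itv/= andbT.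
Qed.

Lemma winE (x : R) : win x = (1 <= x <= 2)%R%:R.
Proof. by rewrite indicE; congr ((nat_of_bool _)%:R); apply/idP/idP; rewrite inE /= in_itv/=. Qed.

Lemma measurable_pos d (T : measurableType d) (f : T -> R) :
  measurable_fun setT f -> measurable_fun setT (fun t => pos (f t)).
Proof. by move=> mf; apply: (measurableT_comp (f := pos)). Qed.

Lemma measurable_win d (T : measurableType d) (f : T -> R) :
  measurable_fun setT f -> measurable_fun setT (fun t => win (f t)).
Proof. by move=> mf; apply: (measurableT_comp (f := win)). Qed.

Lemma radial_ge0 (s u : R) : (0 <= s^-1 * pos s * win u)%R.
Proof.
rewrite posE winE; case: ltP => s0; last by rewrite mulr0 mul0r.
by rewrite !mulr_ge0// invr_ge0 ltW.
Qed.

Lemma measurable_radial d (T : measurableType d) (f g : T -> R) :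
  measurable_fun setT f -> measurable_fun setT g ->
  measurable_fun setT (fun t => (f t)^-1 * pos (f t) * win (g t))%R.
Proof.
move=> mf mg; apply: measurable_funM; last exact: measurable_win.
by apply: measurable_funM; [exact: measurable_funV|exact: measurable_pos].
Qed.

(** Scale invariance of [ds / s], by the substitution [s := u * s]: the windowed mass does not
    depend on the value [u] of the statistic. *)
Lemma radial_massE (u : R) : (0 < u)%R ->
  \int[leb]_s (s^-1 * pos s * win (u / s))%:E = radial_mass.
Proof.
move=> u0; rewrite (ge0_integral_affine 0%R u0); last 2 first.
- by apply/measurable_EFinP; apply: measurable_radial => //; exact: measurable_fun_div.
- by move=> s; rewrite lee_fin; exact: radial_ge0.
rewrite -ge0_integralZl//; last 3 first.
- apply/measurable_EFinP; apply: measurable_radial.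
    by apply: measurable_funD => //; exact: measurable_funM.
  apply: measurable_fun_div => //.
  by apply: measurable_funD => //; exact: measurable_funM.
- by move=> s _; rewrite lee_fin; exact: radial_ge0.
- by rewrite lee_fin ltW.
apply: eq_integral => s _; rewrite addr0 -EFinM; congr EFin.
have E : (u / (u * s) = s^-1)%R by rewrite invfM mulrA mulfV ?gt_eqF// mul1r.
by rewrite !posE pmulr_rgt0// E !mulrA E.
Qed.

(** The window selects exactly [1/2 <= s <= 1], where the integrand lies between 1 and 2; the lower
    bound is used here and the upper one for finiteness. *)
Lemma radial_mass_gt0 : 0 < radial_mass.
Proof.
apply: (@lt_le_trans _ _ (\int[leb]_s (\1_(`[2^-1%R, 1%R]%classic : set R) s)%:E)).
  rewrite integral_indic// setIT/= lebesgue_measure_itv/= lte_fin.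
  by rewrite invf_lt1 ?ltr1n//= -EFinB lte_fin subr_gt0 invf_lt1 ?ltr1n.
apply: ge0_le_integral => //.
- exact/measurable_EFinP.
- by apply/measurable_EFinP; apply: measurable_radial => //; exact: measurable_funV.
move=> s _; rewrite lee_fin indicE; case: (boolP (s \in _)); last first.
  by move=> _; exact: radial_ge0.
rewrite inE/= in_itv/= => /andP[s1 s2].
have s0 : (0 < s)%R by apply: lt_le_trans s1; rewrite invr_gt0.
have i1 : (1 <= s^-1)%R by rewrite invf_ge1.
have i2 : (s^-1 <= 2)%R by rewrite -[2%R]invrK lef_pV2 ?posrE ?invr_gt0.
by rewrite posE winE s0 i1 i2 !mulr1.
Qed.

Lemma radial_mass_fin : radial_mass \is a fin_num.
Proof.
rewrite ge0_fin_numE; last exact: ltW radial_mass_gt0.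
apply: (@le_lt_trans _ _ (\int[leb]_s (2 * \1_(`[2^-1%R, 1%R]%classic : set R) s)%:E)).
  apply: ge0_le_integral => //.
  - by move=> s _; rewrite lee_fin; exact: radial_ge0.
  - by apply/measurable_EFinP; apply: measurable_radial => //; exact: measurable_funV.
  - by apply/measurable_EFinP; exact: measurable_funM.
  move=> s _; rewrite lee_fin posE winE.
  case: (ltP 0%R s) => s0; last by rewrite mulr0 mul0r mulr_ge0.
  case: andP => [[s1 s2]|_]; last by rewrite mulr0 mulr_ge0.
  rewrite !mulr1 indicE mem_set ?mulr1//= in_itv/=.
  by rewrite -invf_ge1// s1 andbT -[s]invrK lef_pV2 ?posrE ?invr_gt0.
under eq_integral do rewrite EFinM.
rewrite ge0_integralZl//; last exact/measurable_EFinP.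
rewrite integral_indic// setIT/= lebesgue_measure_itv/= lte_fin.
by rewrite invf_lt1 ?ltr1n//= -EFinB -EFinM ltry.
Qed.

Context n p (nu : 'cV[R]_n) (U : 'M[R]_(n, p) -> R).
Hypothesis nu0 : nu != 0%R.
Hypothesis mU : measurable_fun setT (fun t => U (tup2mx t)).
Hypothesis Udil : forall s x, (0 < s)%R -> U (dil nu s x) = (s * U x)%R.

Lemma measurable_dil d (T : measurableType d) (s : T -> R) (g : T -> 'M[R]_(n, p)) :
  measurable_fun setT s -> measurable_mx g ->
  measurable_mx (fun t => dil nu (s t) (g t)).
Proof.
move=> ms mg; apply: measurable_mxD => //; apply: measurable_mxZ.
  apply: measurable_fun_div => //.
  exact: measurable_funB.
by do 2 (apply: measurable_mxM; first exact: measurable_mx_cst).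
Qed.

(** Both sides are double integrals over [(s, x)], of [F] and of [G]. For fixed [s > 0] these
    correspond under [x := dil nu s x], which turns [U x / s] into [U x] and contributes
    [s ^+ p]. *)
Lemma radial_identity (H : 'M[R]_(n, p) -> \bar R) :
  measurable_fun setT (fun t => H (tup2mx t)) -> (forall x, 0 <= H x) ->
  radial_mass * intX (fun x => (pos (U x))%:E * H x) =
  intX (fun x => (pos (U x) * win (U x))%:E *
    \int[leb]_s ((s^-1 * pos s * s ^+ p)%:E * H (dil nu s x))).
Proof.
move=> mH H0; have [m mE] := @iint_measure R (n * p).
have pos_ge0 x : (0 <= pos x)%R by rewrite posE.
have win_ge0 x : (0 <= win x)%R by rewrite winE.
have mX := @measurable_mx_tup2mx R n p.
pose PT := (measurableTypeR R * (n * p).-tuple R)%type.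
have mX2 : measurable_mx (fun z : PT => tup2mx z.2).
  by move=> i j; apply: (measurableT_comp (f := fun t => tup2mx t i j)).
pose F (z : PT) := (z.1^-1 * pos z.1 * win (U (tup2mx z.2) / z.1))%:E *
  ((pos (U (tup2mx z.2)))%:E * H (tup2mx z.2)).
pose G (z : PT) := (pos (U (tup2mx z.2)) * win (U (tup2mx z.2)))%:E *
    ((z.1^-1 * pos z.1 * z.1 ^+ p)%:E * H (dil nu z.1 (tup2mx z.2))).
have mU2 : measurable_fun setT (fun z : PT => U (tup2mx z.2)).
  exact: (measurable_mx_comp (f := U)).
have mF : measurable_fun setT F.
  apply: emeasurable_funM.
    by apply/measurable_EFinP; apply: measurable_radial => //; exact: measurable_fun_div.
  apply: emeasurable_funM; last exact: (measurable_mx_comp (f := H)).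
  by apply/measurable_EFinP; exact: measurable_pos.
have mG : measurable_fun setT G.
  apply: emeasurable_funM.
    apply/measurable_EFinP; apply: measurable_funM; [exact: measurable_pos|exact: measurable_win].
  apply: emeasurable_funM.
    apply/measurable_EFinP; apply: measurable_funM; last exact: measurable_funX.
    by apply: measurable_funM; [exact: measurable_funV|exact: measurable_pos].
  by apply: (measurable_mx_comp (f := H)) => //; exact: measurable_dil.
have F0 z : 0 <= F z.
  by rewrite /F mule_ge0 ?lee_fin ?radial_ge0// mule_ge0 ?lee_fin.
have kp0 s : (0 <= s^-1 * pos s * s ^+ p)%R.
  rewrite posE; case: (ltP 0%R s) => [s0|_]; last by rewrite mulr0 mul0r.
  by rewrite mulr1 mulr_ge0 ?exprn_ge0 ?invr_ge0// ltW.
have G0 z : 0 <= G z.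
  by rewrite /G mule_ge0 ?lee_fin ?mulr_ge0// mule_ge0 ?lee_fin.
have mH2 : measurable_fun setT (fun t : (n * p).-tuple R => (pos (U (tup2mx t)))%:E * H (tup2mx t)).
  by apply: emeasurable_funM => //; apply/measurable_EFinP; exact: measurable_pos.
have H20 x : 0 <= (pos (U x))%:E * H x by rewrite mule_ge0 ?lee_fin.
have L0 := ltW radial_mass_gt0.
transitivity (\int[leb]_s \int[m]_t F (s, t)).
  rewrite /intX mE// -ge0_integralZl//.
  rewrite (fubini_tonelli (m1 := leb) (m2 := m) _ mF F0).
  apply: eq_integral => t _ /=; rewrite /F/=.
  rewrite (@ge0_integralZr _ _ _ leb _ _
    (fun s => (s^-1 * pos s * win (U (tup2mx t) / s))%:E))//; last 2 first.
  - by apply/measurable_EFinP; apply: measurable_radial => //; exact: measurable_fun_div.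
  - by move=> s _; rewrite lee_fin radial_ge0.
  (* Where [U] is not positive the window integral is not [radial_mass], but the factor [pos]
     annihilates both sides. *)
  have [Ut|Ut] := ltP 0%R (U (tup2mx t)); first by rewrite radial_massE.
  by rewrite posE ltNge Ut /= mul0e !mule0.
transitivity (\int[leb]_s \int[m]_t G (s, t)).
  apply: eq_integral => s _.
  have [s0|s0] := ltP 0%R s; last first.
    rewrite !integral0_eq// => t _; rewrite /G /F /= [pos s]posE ltNge s0 /=.
      by rewrite mulr0 mul0r mul0e mule0.
    by rewrite mulr0 mul0r mul0e.
  rewrite /F/= -(mE (fun t => (s^-1 * pos s * win (U (tup2mx t) / s))%:E *
    ((pos (U (tup2mx t)))%:E * H (tup2mx t)))); last 2 first.
  - exact: measurableT_comp mF (pair1_measurable _).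
  - by move=> t; exact: F0 (s, t).
  have := @intX_dil R n p nu s (fun x => (s^-1 * pos s * win (U x / s))%:E *
    ((pos (U x))%:E * H x)) nu0 s0.
  rewrite /intX => ->; last 2 first.
  - exact: measurableT_comp mF (pair1_measurable _).
  - by move=> x; rewrite mule_ge0 ?lee_fin ?radial_ge0.
  rewrite mE; last 2 first.
  - have mD : measurable_mx (fun t : (n * p).-tuple R => dil nu s (tup2mx t)).
      exact: measurable_dil.
    apply: (measurable_mx_comp (f := fun x => (s^-1 * pos s * win (U x / s))%:E *
    ((pos (U x))%:E * H x))) mD.
    exact: measurableT_comp mF (pair1_measurable _).
  - by move=> t; rewrite mule_ge0 ?lee_fin ?radial_ge0.
  rewrite -ge0_integralZl//; last 3 first.
  - have mD : measurable_mx (fun t : (n * p).-tuple R => dil nu s (tup2mx t)).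
      exact: measurable_dil.
    apply: (measurable_mx_comp (f := fun x => (s^-1 * pos s * win (U x / s))%:E *
    ((pos (U x))%:E * H x))) mD.
    exact: measurableT_comp mF (pair1_measurable _).
  - by move=> t _; rewrite mule_ge0 ?lee_fin ?radial_ge0.
  - by rewrite lee_fin exprn_ge0// ltW.
  apply: eq_integral => t _; rewrite /G/= Udil// [(s * _ / s)%R]mulrAC divff ?gt_eqF// mul1r.
  rewrite !muleA -!EFinM; congr (_%:E * _).
  rewrite [pos (s * _)%R]posE pmulr_rgt0// -posE.
  ring.
rewrite (fubini_tonelli (m1 := leb) (m2 := m) _ mG G0)/intX.
have GE t : \int[leb]_s G (s, t) = (pos (U (tup2mx t)) * win (U (tup2mx t)))%:E *
  \int[leb]_s ((s^-1 * pos s * s ^+ p)%:E * H (dil nu s (tup2mx t))).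
  rewrite /G/= ge0_integralZl//.
  - apply: emeasurable_funM.
      apply/measurable_EFinP; apply: measurable_funM; last exact: measurable_funX.
      by apply: measurable_funM; [exact: measurable_funV|exact: measurable_pos].
    by apply: (measurable_mx_comp (f := H)) => //; exact: measurable_dil.
  - by move=> s _; rewrite mule_ge0 ?lee_fin.
have {}GE := esym (funext GE).
rewrite [X in _ = iint X]GE; apply/esym/mE.
- exact: (measurable_fun_fubini_tonelli_G (m1 := leb) _ mG G0).
- by move=> t; apply: integral_ge0 => s _; exact: G0.
Qed.

Lemma radial_comparison (H1 H2 : 'M[R]_(n, p) -> \bar R) :
  measurable_fun setT (fun t => H1 (tup2mx t)) -> (forall x, 0 <= H1 x) ->
  measurable_fun setT (fun t => H2 (tup2mx t)) -> (forall x, 0 <= H2 x) ->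
  (forall x, (0 < U x)%R ->
     \int[leb]_s ((s^-1 * pos s * s ^+ p)%:E * H1 (dil nu s x)) =
     \int[leb]_s ((s^-1 * pos s * s ^+ p)%:E * H2 (dil nu s x))) ->
  intX (fun x => (pos (U x))%:E * H1 x) = intX (fun x => (pos (U x))%:E * H2 x).
Proof.
move=> mH1 H10 mH2 H20 H12.
suff E : radial_mass * intX (fun x => (pos (U x))%:E * H1 x) =
  radial_mass * intX (fun x => (pos (U x))%:E * H2 x).
  (* The integrals may be infinite; cancelling in each inequality only needs the factor
     [radial_mass] to be finite and positive. *)
  apply: le_anti; apply/andP.
  by split; rewrite -(lee_pmul2l radial_mass_fin radial_mass_gt0) E.
rewrite !radial_identity//; congr intX; apply/funext => x.
have [Ux|Ux] := ltP 0%R (U x); first by rewrite H12.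
by rewrite [pos (U x)]posE ltNge Ux /= !mul0r !mul0e.
Qed.

End RadialComparison.

(** * The test statistics and the Gaussian exponent under dilations *)

Section Statistics.
Context {R : realType} (n p : nat).
Variables (mu : 'M[R]_(n, p)) (Sigma Sh : 'M[R]_p) (C1 C2 : {set 'I_n}).
Local Notation nu := (nuvec R C1 C2).

Lemma sqnorm_ge0 k (v : 'cV[R]_k) : 0 <= sqnorm v.
Proof. by apply: sumr_ge0 => i _; exact: sqr_ge0. Qed.

Lemma sqnorm_eq0 k (v : 'cV[R]_k) : (sqnorm v == 0) = (v == 0).
Proof.
apply/eqP/eqP => [v0|->]; last first.
  by rewrite /sqnorm big1// => i _; rewrite mxE expr0n.
apply/matrixP => i j; rewrite ord1 mxE; apply/eqP; rewrite -sqrf_eq0.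
have /eqP := v0; rewrite psumr_eq0; last by move=> k0 _; exact: sqr_ge0.
by move=> /allP/(_ i); rewrite mem_index_enum => /(_ isT).
Qed.

Lemma vnorm_sqr k (v : 'cV[R]_k) : vnorm v ^+ 2 = sqnorm v.
Proof. by rewrite sqr_sqrtr// sqnorm_ge0. Qed.

Lemma vnorm_eq0 k (v : 'cV[R]_k) : (vnorm v == 0) = (v == 0).
Proof. by rewrite -sqrf_eq0 vnorm_sqr sqnorm_eq0. Qed.

Lemma vnorm_ge0 k (v : 'cV[R]_k) : 0 <= vnorm v.
Proof. exact: sqrtr_ge0. Qed.

Lemma vnorm_gt0 k (v : 'cV[R]_k) : v != 0 -> 0 < vnorm v.
Proof. by move=> v0; rewrite lt_def vnorm_ge0 vnorm_eq0 v0. Qed.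

Lemma vnormZ k (s : R) (v : 'cV[R]_k) : 0 <= s -> vnorm (s *: v) = s * vnorm v.
Proof.
move=> s0; rewrite /vnorm.
under eq_bigr do rewrite mxE exprMn.
by rewrite -mulr_sumr sqrtrM ?sqr_ge0// sqrtr_sqr ger0_norm.
Qed.

Lemma mulTmx_sqnorm k (v : 'cV[R]_k) : v^T *m v = (sqnorm v)%:M.
Proof.
rewrite [LHS]mx11_scalar mxE; congr (_ %:M).
by apply: eq_bigr => i _; rewrite mxE expr2.
Qed.

(** An index lying in only one of the two clusters gives a non-zero entry; exchanging the clusters
    negates [nu]. *)
Lemma nuvec_neq0 : C1 != C2 -> nu != 0.
Proof.
have key (A B : {set 'I_n}) : ~~ (A \subset B) -> nuvec R A B != 0.
  case/subsetPn => i iA iB; apply/eqP => /matrixP/(_ i 0); rewrite !mxE.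
  rewrite iA (negbTE iB) mul0r subr0 mul1r => /eqP; rewrite invr_eq0 pnatr_eq0.
  by rewrite cards_eq0 => /eqP A0; rewrite A0 inE in iA.
rewrite finset.eqEsubset negb_and => /orP[/key//|/key].
rewrite (_ : nuvec R C2 C1 = - nu) ?oppr_eq0//.
by apply/matrixP => i j; rewrite !mxE opprB.
Qed.

(** Through this identity the null hypothesis becomes the orthogonality [nu^T *m mu = 0]. *)
Lemma nuvec_mul (x : 'M[R]_(n, p)) : nu^T *m x = clmean x C1 - clmean x C2.
Proof.
have key (C : {set 'I_n}) j : clmean x C 0 j = \sum_i (i \in C)%:R / #|C|%:R * x i j.
  rewrite mxE summxE mulr_sumr big_mkcond/=; apply: eq_bigr => i _.
  by rewrite mxE; case: (i \in C); rewrite ?mul1r// !mul0r.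
apply/matrixP => i j; rewrite !ord1 mxE [RHS]mxE [X in _ + X]mxE !key.
by rewrite -sumrB; apply: eq_bigr => k _; rewrite !mxE mulrBl.
Qed.

Hypothesis nu0 : nu != 0.
Local Notation N := (sqnorm nu).

Let N0 : N != 0. Proof. by rewrite sqnorm_eq0. Qed.

Lemma trmx_dil (s : R) (x : 'M[R]_(n, p)) : nu^T *m dil nu s x = s *: (nu^T *m x).
Proof.
rewrite mulmxDr -scalemxAr [nu^T *m (nu *m _)]mulmxA mulTmx_sqnorm mul_scalar_mx scalerA.
by rewrite divfK// scalerBl scale1r addrC subrK.
Qed.

Lemma wvecE (x : 'M[R]_(n, p)) : wvec Sh C1 C2 x = invmx Sh *m (nu^T *m x)^T.
Proof. by rewrite /wvec trmx_mul trmxK mulmxA. Qed.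

Lemma wvec_dil (s : R) x : wvec Sh C1 C2 (dil nu s x) = s *: wvec Sh C1 C2 x.
Proof. by rewrite !wvecE trmx_dil linearZ/= -scalemxAr. Qed.

Lemma Ustat_ge0 (x : 'M[R]_(n, p)) : 0 <= Ustat Sh C1 C2 x.
Proof. exact: vnorm_ge0. Qed.

Lemma Ustat_dil (s : R) (x : 'M[R]_(n, p)) :
  0 < s -> Ustat Sh C1 C2 (dil nu s x) = s * Ustat Sh C1 C2 x.
Proof. by move=> s0; rewrite /Ustat wvec_dil vnormZ// ltW. Qed.

(** The factor [s] cancels in the normalised direction, and the projection in the second component
    kills [nu]. *)
Lemma Astat_dil (s : R) (x : 'M[R]_(n, p)) :
  0 < s -> Astat Sh C1 C2 (dil nu s x) = Astat Sh C1 C2 x.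
Proof.
move=> s0; have Pnu : (1%:M - N^-1 *: (nu *m nu^T)) *m nu = 0.
  rewrite mulmxBl mul1mx -scalemxAl -mulmxA mulTmx_sqnorm mul_mx_scalar scalerA.
  by rewrite mulVf// scale1r subrr.
rewrite /Astat; congr pair.
  rewrite wvec_dil vnormZ ?ltW// scalerA invfM mulrAC mulVf ?gt_eqF//.
  by rewrite mul1r.
rewrite vnorm_sqr [dil _ _ _]/dil mulmxDr -[RHS]addr0; congr (_ + _).
by rewrite -scalemxAr [X in _ *: X]mulmxA Pnu mul0mx scaler0.
Qed.

Hypothesis Shu : Sh \in unitmx.
Hypothesis ShT : Sh^T = Sh.

Lemma Ustat_eq0_dil (s : R) (x : 'M[R]_(n, p)) :
  Ustat Sh C1 C2 x = 0 -> dil nu s x = x.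
Proof.
move/eqP; rewrite vnorm_eq0 wvecE => /eqP/(congr1 (mulmx Sh)).
rewrite mulmxA mulmxV// mul1mx mulmx0 => /(congr1 trmx); rewrite trmxK => E.
by rewrite /dil E trmx0 mulmx0 scaler0 addr0.
Qed.

(** Identifies the dilation orbit of [x] with the ray used in [Fcdf], parametrised by [v = s * U]:
    the norm cancels against the normalisation of the direction, and [Sh] against its inverse. *)
Lemma Xu_Astat (s : R) (x : 'M[R]_(n, p)) : 0 < Ustat Sh C1 C2 x ->
  Xu Sh C1 C2 (s * Ustat Sh C1 C2 x) (Astat Sh C1 C2 x) = dil nu s x.
Proof.
move=> U0; rewrite /Xu /Astat /= vnorm_sqr -/(Ustat Sh C1 C2 x).
rewrite wvecE linearZ/= trmx_mul trmxK trmx_inv ShT -scalemxAr -scalemxAl.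
rewrite -!mulmxA mulVmx// mulmx1 scalerA mulmxBl mul1mx -scalemxAl -mulmxA.
rewrite mulrAC mulfK ?gt_eqF// /dil mulrBl scalerBl mul1r.
by rewrite addrCA.
Qed.

Hypothesis ShSh : Sh *m Sh = Sigma.
Hypothesis H0 : clmean mu C1 = clmean mu C2.

Lemma Sigma_inv : invmx Sigma = invmx Sh *m invmx Sh.
Proof.
have Su : Sigma \in unitmx by rewrite -ShSh unitmx_mul Shu.
apply: (can_inj (mulKmx Su)); rewrite mulmxV// -ShSh mulmxA.
by rewrite mulmxK// mulmxV.
Qed.

(** Pythagoras: [dil nu s x - mu] is a multiple of [nu *m z] plus [b], and [nu^T *m b = 0] under the
    null hypothesis, so the cross terms vanish by cyclicity of the trace. *)
Lemma quadratic_form_dil (s : R) (x : 'M[R]_(n, p)) :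
  let b := dil nu 0 x - mu in
  \tr ((dil nu s x - mu) *m invmx Sigma *m (dil nu s x - mu)^T) =
  (s * Ustat Sh C1 C2 x / vnorm nu) ^+ 2 + \tr (b *m invmx Sigma *m b^T).
Proof.
move=> b; pose z := nu^T *m x.
have -> : dil nu s x - mu = (s / N) *: (nu *m z) + b.
  rewrite /b /dil -/z addrA addrCA; congr (_ + _ - _).
  rewrite -scalerDl; congr (_ *: _).
  by rewrite -mulrDl sub0r.
have nub : nu^T *m b = 0.
  by rewrite /b mulmxBr trmx_dil scale0r nuvec_mul H0 subrr subr0.
have bnu : b^T *m nu = 0.
  by rewrite -[nu]trmxK -trmx_mul nub trmx0.
set a := (s / N) *: _.
have -> : \tr ((a + b) *m invmx Sigma *m (a + b)^T) =
    (\tr (a *m invmx Sigma *m a^T) + \tr (b *m invmx Sigma *m a^T)) +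
    (\tr (a *m invmx Sigma *m b^T) + \tr (b *m invmx Sigma *m b^T)).
  by rewrite linearD/= mulmxDr !mulmxDl !linearD/=.
have -> : \tr (a *m invmx Sigma *m b^T) = 0.
  rewrite -!scalemxAl linearZ/= -!mulmxA mxtrace_mulC -!mulmxA bnu !mulmx0.
  by rewrite mxtrace0 mulr0.
have -> : \tr (b *m invmx Sigma *m a^T) = 0.
  rewrite linearZ/= -scalemxAr linearZ/= trmx_mul mulmxA mxtrace_mulC.
  by rewrite !mulmxA nub !mul0mx mxtrace0 mulr0.
rewrite addr0 add0r; congr (_ + _); rewrite /a.
rewrite [((s / N) *: _)^T]linearZ/= -!scalemxAl -scalemxAr !linearZ/= trmx_mul.
rewrite -!mulmxA mxtrace_mulC -!mulmxA mulTmx_sqnorm mul_mx_scalar -!scalemxAr.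
(* Splitting the inverse of [Sigma] into two inverses of [Sh] makes the remaining form the squared
   norm of [wvec], that is [U^2]. *)
have -> : nu^T *m (x *m (invmx Sigma *m z^T)) = (wvec Sh C1 C2 x)^T *m wvec Sh C1 C2 x.
  have wT : (wvec Sh C1 C2 x)^T = nu^T *m x *m invmx Sh.
    by rewrite wvecE trmx_mul trmxK trmx_inv ShT.
  by rewrite wT wvecE Sigma_inv !mulmxA.
rewrite mulTmx_sqnorm linearZ/= mxtrace_scalar mulr1n.
rewrite expr_div_n exprMn !vnorm_sqr; field.
exact: N0.
Qed.

End Statistics.

(** * The chi density: positivity, measurability, finite mass *)

Section ChiDensity.
Context {R : realType}.
Local Notation leb := (@lebesgue_measure R).

Lemma chi_kernel_ge0 p (x : R) : 0 <= x -> 0 <= chi_kernel p x.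
Proof. by move=> x0; rewrite mulr_ge0 ?exprn_ge0 ?expR_ge0. Qed.

Lemma measurable_chi_kernel p : measurable_fun setT (@chi_kernel R p).
Proof.
apply: measurable_funM; first exact: exprn_measurable.
apply: (measurableT_comp (@measurable_expR R)).
by apply: measurable_funM => //; apply: measurableT_comp.
Qed.

(* Follows from [x <= exp x] and [p x - x^2 / 2 <= p^2 / 2]. *)
Lemma chi_kernel_le p (x : R) : 0 <= x ->
  chi_kernel p x <= expR (p.-1.+1%:R ^+ 2 / 2) * expR (- x).
Proof.
move=> x0; rewrite /chi_kernel; set k := p.-1.
have xk : x ^+ k <= expR (k%:R * x).
  rewrite mulrC expRM_natr lerXn2r ?nnegrE ?expR_ge0//.
  by apply: le_trans (expR_ge1Dx x); rewrite lerDr.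
apply: (@le_trans _ _ (expR (k%:R * x) * expR (- x ^+ 2 / 2))).
  by rewrite ler_wpM2r ?expR_ge0.
rewrite -!expRD ler_expR -subr_ge0.
rewrite (_ : _ - _ = (x - k.+1%:R) ^+ 2 / 2); first by rewrite divr_ge0 ?sqr_ge0.
by rewrite -natr1; field.
Qed.

Lemma measurable_expRN (r : R) (D : set R) :
  measurable_fun D (fun x => (expR (- (r * x)))%:E).
Proof.
apply/measurable_EFinP; apply: measurable_funTS.
apply: (measurableT_comp (@measurable_expR R)).
by apply: measurableT_comp => //; exact: measurable_funM.
Qed.

Lemma integral_expRN_lty (r : R) : 0 < r ->
  (\int[leb]_(x in `[0%R, +oo[) (expR (- (r * x)))%:E < +oo)%E.
Proof.
move=> r0; have := integral_exponential_pdf r0.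
rewrite (_ : (fun x => _) = (fun x => (r * expR (- (r * x)))%:E) \_ `[0%R, +oo[); last first.
  apply/funext => x; rewrite /exponential_pdf !patchE; case: ifP => //.
  by rewrite mulNr.
rewrite -integral_mkcond.
under eq_integral do rewrite EFinM.
rewrite ge0_integralZl//; last 2 first.
- exact: measurable_expRN.
- by rewrite lee_fin ltW.
set I := (\int[_]_(_ in _) _)%E => rI.
have : (I != +oo)%E by apply/eqP => Iy; move: rI; rewrite Iy gt0_muley// lte_fin.
by rewrite ltey.
Qed.

Lemma integral_chi_kernel_lty p :
  (\int[leb]_(x in `[0%R, +oo[) (chi_kernel p x)%:E < +oo)%E.
Proof.
pose K : R := expR (p.-1.+1%:R ^+ 2 / 2).
apply: (@le_lt_trans _ _
  (\int[leb]_(x in `[0%R, +oo[) (K%:E * (expR (- (1 * x)))%:E))%E).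
  apply: ge0_le_integral => //.
  - by move=> x /=; rewrite in_itv/= andbT => x0; rewrite lee_fin chi_kernel_ge0.
  - by apply/measurable_EFinP; apply: measurable_funTS; exact: measurable_chi_kernel.
  - by apply: emeasurable_funM => //; exact: measurable_expRN.
  - move=> x /=; rewrite in_itv/= andbT => x0.
    by rewrite -EFinM lee_fin mul1r chi_kernel_le.
rewrite ge0_integralZl//.
- by rewrite lte_mul_pinfty ?lee_fin ?expR_ge0// integral_expRN_lty.
- exact: measurable_expRN.
- by rewrite lee_fin expR_ge0.
Qed.

(** Finiteness of the integral matters as well, since [fine] sends [+oo] to 0. On [[1, 2]] the
    kernel is at least [expR (- 2)], because [x ^+ p.-1 >= 1] and [x ^+ 2 / 2 <= 2]. *)
Lemma chi_const_gt0 p : 0 < chi_const R p.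
Proof.
rewrite /chi_const fine_gt0// integral_chi_kernel_lty andbT.
apply: (@lt_le_trans _ _ (\int[leb]_(x in `[1%R, 2%R]) (expR (- 2) : R)%:E)%E).
  rewrite integral_cst//= lebesgue_measure_itv/= lte_fin ltr1n/= -EFinB -EFinM lte_fin.
  by rewrite mulr_gt0 ?expR_gt0// subr_gt0 ltr1n.
apply: (@le_trans _ _ (\int[leb]_(x in `[1%R, 2%R]) (chi_kernel p x)%:E)%E).
  apply: ge0_le_integral => //.
  - by apply/measurable_EFinP; apply: measurable_funTS; exact: measurable_chi_kernel.
  move=> x /=; rewrite in_itv/= => /andP[x1 x2]; rewrite lee_fin /chi_kernel.
  rewrite -[leLHS]mul1r ler_pM ?expR_ge0 ?exprn_ege1// ler_expR.
  have x0 : 0 <= x by exact: le_trans x1.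
  have : x ^+ 2 <= 2 ^+ 2 by rewrite lerXn2r// nnegrE.
  by move=> h; lra.
apply: ge0_subset_integral => //.
- by apply/measurable_EFinP; apply: measurable_funTS; exact: measurable_chi_kernel.
- by move=> x /=; rewrite in_itv/= andbT => x0; rewrite lee_fin chi_kernel_ge0.
- by move=> x /=; rewrite !in_itv/= andbT => /andP[x1 _]; exact: le_trans x1.
Qed.

Lemma scaled_chi_densityE p (c v : R) : 0 < c -> 0 <= v ->
  scaled_chi_density p c v = (c * chi_const R p)^-1 * chi_kernel p (v / c).
Proof.
move=> c0 v0; rewrite /scaled_chi_density /chi_density divr_ge0 ?(ltW c0)//.
by rewrite /= invfM; ring.
Qed.

Lemma scaled_chi_density_ge0 p (c v : R) : 0 < c -> 0 <= scaled_chi_density p c v.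
Proof.
move=> c0; rewrite /scaled_chi_density mulr_ge0 ?invr_ge0 ?(ltW c0)//.
rewrite /chi_density; case: ifP => // v0.
by rewrite divr_ge0 ?chi_kernel_ge0// ltW// chi_const_gt0.
Qed.

Lemma measurable_scaled_chi_density p (c : R) :
  measurable_fun setT (@scaled_chi_density R p c).
Proof.
apply: measurable_funM => //.
rewrite (_ : (fun u => _) = (@chi_density R p) \o (fun u => u / c))//.
apply: measurableT_comp; last exact: measurable_funM.
apply: measurable_fun_ifT => //; first exact: measurable_fun_ler.
by apply: measurable_funM => //; exact: measurable_chi_kernel.
Qed.

Lemma integral_scaled_chi_density_lty p (c : R) : 0 < c ->
  (\int[leb]_(v in `[0%R, +oo[) (scaled_chi_density p c v)%:E < +oo)%E.
Proof.
move=> c0; pose K : R := (c * chi_const R p)^-1 * expR (p.-1.+1%:R ^+ 2 / 2).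
have cc : 0 < (c * chi_const R p)^-1.
  by rewrite invr_gt0 mulr_gt0// chi_const_gt0.
have K0 : 0 <= K by rewrite mulr_ge0 ?expR_ge0// ltW.
apply: (@le_lt_trans _ _
  (\int[leb]_(x in `[0%R, +oo[) (K%:E * (expR (- (c^-1 * x)))%:E))%E).
  apply: ge0_le_integral => //.
  - by move=> x _; rewrite lee_fin scaled_chi_density_ge0.
  - by apply/measurable_EFinP; apply: measurable_funTS; exact: measurable_scaled_chi_density.
  - by apply: emeasurable_funM => //; exact: measurable_expRN.
  - move=> x /=; rewrite in_itv/= andbT => x0.
    rewrite -EFinM lee_fin scaled_chi_densityE// /K -mulrA ler_wpM2l//; first exact: ltW.
    by rewrite [c^-1 * x]mulrC chi_kernel_le// divr_ge0// ltW.
rewrite ge0_integralZl//.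
- by rewrite lte_mul_pinfty// integral_expRN_lty// invr_gt0.
- exact: measurable_expRN.
Qed.

End ChiDensity.

(** * The Gaussian density restricted to a ray *)

Section DensityAlongRays.
Context {R : realType} (n p : nat).
Variables (mu : 'M[R]_(n, p)) (Sigma Sh : 'M[R]_p) (C1 C2 : {set 'I_n}).
Local Notation nu := (nuvec R C1 C2).
Hypothesis p0 : (0 < p)%N.
Hypothesis nu0 : nu != 0.
Hypothesis Shu : Sh \in unitmx.
Hypothesis ShT : Sh^T = Sh.
Hypothesis ShSh : Sh *m Sh = Sigma.
Hypothesis H0 : clmean mu C1 = clmean mu C2.

(** The factor independent of [s] in [mn_density_dil]: the density at the foot [dil nu 0 x] of the
    ray, a power of [vnorm nu / U] from expressing [s] through [s * U / vnorm nu], and the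
    normalisation of the scaled chi density. *)
Definition ray_mass (x : 'M[R]_(n, p)) : R :=
  mn_density mu Sigma (dil nu 0 x) *
  (vnorm nu / Ustat Sh C1 C2 x) ^+ p.-1 * (vnorm nu * chi_const R p).

Lemma mn_density_ge0 (x : 'M[R]_(n, p)) : 0 <= mn_density mu Sigma x.
Proof. by rewrite divr_ge0 ?expR_ge0// mulr_ge0 ?sqrtr_ge0. Qed.

Lemma mn_density_dil (s : R) (x : 'M[R]_(n, p)) :
  0 < s -> 0 < Ustat Sh C1 C2 x ->
  s^-1 * s ^+ p * mn_density mu Sigma (dil nu s x) =
  ray_mass x * scaled_chi_density p (vnorm nu) (s * Ustat Sh C1 C2 x).
Proof.
move=> s0 U0; set U := Ustat Sh C1 C2 x in U0 *; set c := vnorm nu.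
have c0 : 0 < c by exact: vnorm_gt0.
have cc := chi_const_gt0 (R := R) p.
rewrite scaled_chi_densityE//; last by rewrite mulr_ge0// ltW.
(* [0 < p] enters here: the truncated predecessor would give the wrong exponent at [p = 0]. *)
have -> : s^-1 * s ^+ p = s ^+ p.-1.
  by rewrite -{1}(prednK p0) exprS mulrA mulVf ?mul1r// gt_eqF.
have -> : mn_density mu Sigma (dil nu s x) =
    expR (- (s * U / c) ^+ 2 / 2) * mn_density mu Sigma (dil nu 0 x).
  rewrite /mn_density (quadratic_form_dil nu0 Shu ShT ShSh H0 s x) -/U -/c.
  by rewrite opprD mulrDl expRD mulrA.
have E : s ^+ p.-1 = (c / U) ^+ p.-1 * (s * U / c) ^+ p.-1.
  rewrite -exprMn; congr (_ ^+ _); field.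
  by rewrite !gt_eqF.
rewrite /ray_mass -/U -/c E /chi_kernel; field.
by rewrite !gt_eqF.
Qed.

End DensityAlongRays.

(** * Measurability of the statistics and of the Gaussian density *)

Section StatisticsMeasurability.
Context {R : realType} (n p : nat) d (T : measurableType d).
Variables (Sh : 'M[R]_p) (C1 C2 : {set 'I_n}).
Variable x : T -> 'M[R]_(n, p).
Hypothesis mx : measurable_mx x.

Lemma measurable_vnorm k (w : T -> 'cV[R]_k) :
  measurable_mx w -> measurable_fun setT (fun t => vnorm (w t)).
Proof.
move=> mw; apply: measurable_fun_sqrt; apply: measurable_sum => i.
exact: measurable_funX.
Qed.

Lemma measurable_wvec : measurable_mx (fun t => wvec Sh C1 C2 (x t)).
Proof.
apply: measurable_mxM; last exact: measurable_mx_cst.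
apply: measurable_mxM; first exact: measurable_mx_cst.
exact: measurable_mxT.
Qed.

Lemma measurable_Ustat : measurable_fun setT (fun t => Ustat Sh C1 C2 (x t)).
Proof. exact/measurable_vnorm/measurable_wvec. Qed.

Lemma measurable_Xu (v : T -> R) : measurable_fun setT v ->
  measurable_mx (fun t => Xu Sh C1 C2 (v t) (Astat Sh C1 C2 (x t))).
Proof.
move=> mv; apply: measurable_mxD.
  apply: measurable_mxZ; first exact: measurable_funM.
  apply: measurable_mxM; last exact: measurable_mx_cst.
  apply: measurable_mxM; first exact: measurable_mx_cst.
  apply: measurable_mxT; apply: measurable_mxZ; last exact: measurable_wvec.
  by apply: measurable_funV; exact: measurable_Ustat.
by apply: measurable_mxM => //; exact: measurable_mx_cst.
Qed.

Lemma measurable_mn_density (mu : 'M[R]_(n, p)) (Sigma : 'M[R]_p) :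
  measurable_fun setT (fun t => mn_density mu Sigma (x t)).
Proof.
apply: measurable_funM => //; apply: (measurableT_comp (@measurable_expR R)).
apply: measurable_funM => //; apply: measurableT_comp => //.
apply: measurable_sum => i.
have mxmu : measurable_mx (fun t => x t - mu).
  by apply: measurable_mxD => //; exact: measurable_mx_cst.
apply: (measurable_mxM (f := fun t => (x t - mu) *m invmx Sigma)).
  by apply: measurable_mxM => //; exact: measurable_mx_cst.
exact: measurable_mxT.
Qed.

End StatisticsMeasurability.

(** * Bounds and measurability of the merge-path probability *)

Section PathProbability.
Context {R : realType} (n p : nat).
Variables (d : {set {set 'I_n}} -> 'M[R]_(n, p) -> R) (tau : R).

Lemma merge_prob_ge0 cl M x : 0 <= merge_prob d tau cl M x.
Proof.
rewrite /merge_prob; case: ifP => // _.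
by rewrite divr_ge0 ?expR_ge0// sumr_ge0// => i _; exact: expR_ge0.
Qed.

Lemma merge_prob_le1 cl M x : merge_prob d tau cl M x <= 1.
Proof.
rewrite /merge_prob; case: ifP => // Mcl.
have s0 : 0 < \sum_(M' in candidates cl) expR (- d M' x / temp d tau cl x).
  rewrite (bigD1 M)//=; apply: ltr_pwDl; first exact: expR_gt0.
  by apply: sumr_ge0 => i _; exact: expR_ge0.
rewrite ler_pdivrMr// mul1r (bigD1 M)//= lerDl.
by apply: sumr_ge0 => i _; exact: expR_ge0.
Qed.

Lemma path_prob_ge0 ms x : 0 <= path_prob d tau ms x.
Proof. by apply: prodr_ge0 => s _; exact: merge_prob_ge0. Qed.

Lemma path_prob_le1 ms x : path_prob d tau ms x <= 1.
Proof.
by apply: prodr_ile1 => s _; rewrite merge_prob_ge0 merge_prob_le1.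
Qed.

Hypothesis md : forall M, mx_measurable_fun (d M).

Lemma measurable_path_prob ms :
  measurable_fun setT (fun t => path_prob d tau ms (tup2mx t)).
Proof.
apply: measurable_prod => s _; rewrite /merge_prob.
set cl := clusters_after _.
have mtemp : measurable_fun setT (fun t => temp d tau cl (tup2mx t)).
  apply: measurable_funM => //; apply: measurable_funM => //.
  under eq_fun do rewrite big_mkcond.
  by apply: measurable_sum => M; case: (M \in _) => //; exact: md.
have mexp M : measurable_fun setT
    (fun t => expR (- d M (tup2mx t) / temp d tau cl (tup2mx t))).
  apply: (measurableT_comp (@measurable_expR R)).
  apply: measurable_fun_div => //; apply: measurableT_comp => //.
  exact: md.
case: (_ \in candidates cl) => //.
apply: measurable_fun_div => //.
under eq_fun do rewrite big_mkcond.
by apply: measurable_sum => M; case: (M \in _).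
Qed.

End PathProbability.

(** * Numerator and denominator of the conditional distribution function *)

Section RayIntegrals.
Context {R : realType} (n p : nat).
Variables (mu : 'M[R]_(n, p)) (Sigma Sh : 'M[R]_p) (C1 C2 : {set 'I_n}).
Variables (d : {set {set 'I_n}} -> 'M[R]_(n, p) -> R) (tau : R).
Variable ms : seq {set {set 'I_n}}.
Local Notation nu := (nuvec R C1 C2).
Local Notation leb := (@lebesgue_measure R).
Local Notation U := (Ustat Sh C1 C2).
Local Notation A := (Astat Sh C1 C2).
Local Notation q := (path_prob d tau ms).
Local Notation F := (Fcdf d tau Sh C1 C2 ms).
Local Notation pos := (\1_(`]0%R, +oo[%classic : set R) : R -> R).
Hypothesis md : forall M, mx_measurable_fun (d M).
Hypothesis nu0 : nu != 0.

Definition ray_density x (v : R) : R :=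
  scaled_chi_density p (vnorm nu) v * q (Xu Sh C1 C2 v (A x)).

(** A general right bound treats the numerator, [BRight u], and the denominator, [+oo%O],
    together. *)
Definition ray_int (b : itv_bound R) x : \bar R :=
  (\int[leb]_(v in [set` Interval (BLeft 0%R) b]) (ray_density x v)%:E)%E.

Lemma ray_density_ge0 x v : 0 <= ray_density x v.
Proof.
by rewrite mulr_ge0 ?path_prob_ge0// scaled_chi_density_ge0// vnorm_gt0.
Qed.

Lemma measurable_ray_density dT (T : measurableType dT) (x : T -> 'M[R]_(n, p))
    (v : T -> R) : measurable_mx x -> measurable_fun setT v ->
  measurable_fun setT (fun t => ray_density (x t) (v t)).
Proof.
move=> mx mv; apply: measurable_funM.
  exact: measurableT_comp (measurable_scaled_chi_density _ _) mv.
apply: (measurable_mx_comp (f := q)); first exact: measurable_path_prob.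
exact: measurable_Xu.
Qed.

Lemma measurable_ray_int b : measurable_fun setT (fun t => ray_int b (tup2mx t)).
Proof.
pose PT := (measurableTypeR R * (n * p).-tuple R)%type.
pose G (z : PT) := ((ray_density (tup2mx z.2) z.1)%:E *
  (\1_([set` Interval (BLeft 0%R) b] : set R) z.1)%:E)%E.
have mG : measurable_fun setT G.
  apply: emeasurable_funM; apply/measurable_EFinP.
    apply: (measurable_ray_density (x := fun z : PT => tup2mx z.2) (v := fst)) => //.
    by move=> i j; apply: (measurableT_comp (f := fun t => tup2mx t i j)) => //;
      exact: measurable_mx_tup2mx.
  have mI : measurable_fun [set: measurableTypeR R]
    (\1_([set` Interval (BLeft 0%R) b] : set R) : R -> R) by exact: measurable_indic.
  exact: measurableT_comp mI measurable_fst.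
have G0 z : (0 <= G z)%E by rewrite mule_ge0// lee_fin ray_density_ge0.
rewrite (_ : (fun t => _) = (fun t => \int[leb]_v G (v, t)))%E.
  exact: (measurable_fun_fubini_tonelli_G (m1 := leb) _ mG G0).
by apply/funext => t; rewrite /ray_int integral_mkcond epatch_indic.
Qed.

Lemma measurable_ray_density_r x D : measurable_fun D (fun v => (ray_density x v)%:E).
Proof.
apply/measurable_EFinP; apply: measurable_funTS.
by apply: (measurable_ray_density (x := cst x)) => //; exact: measurable_mx_cst.
Qed.

Lemma ray_int_ge0 b x : (0 <= ray_int b x)%E.
Proof. by apply: integral_ge0 => v _; rewrite lee_fin ray_density_ge0. Qed.

Lemma ray_int_le b x : (ray_int b x <= ray_int +oo%O x)%E.
Proof.
apply: ge0_subset_integral => //.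
- exact: measurable_ray_density_r.
- by move=> v _; rewrite lee_fin ray_density_ge0.
- by move=> v /=; rewrite !in_itv/= => /andP[-> _].
Qed.

(** The path probability is at most 1, so the scaled chi density dominates. *)
Lemma ray_int_lty b x : (ray_int b x < +oo)%E.
Proof.
apply: le_lt_trans (ray_int_le b x) _.
apply: le_lt_trans (integral_scaled_chi_density_lty p (vnorm_gt0 nu0)).
apply: ge0_le_integral => //.
- by move=> v _; rewrite lee_fin ray_density_ge0.
- exact: measurable_ray_density_r.
- by apply/measurable_EFinP; apply: measurable_funTS;
    exact: measurable_scaled_chi_density.
- move=> v _; rewrite lee_fin ler_piMr ?path_prob_le1//.
  exact/scaled_chi_density_ge0/vnorm_gt0.
Qed.

Lemma ray_int_fin b x : ray_int b x \is a fin_num.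
Proof. by rewrite ge0_fin_numE ?ray_int_ge0// ray_int_lty. Qed.

Lemma FcdfE u x : F u (A x) =
  fine (ray_int (BRight u) x) / fine (ray_int +oo%O x).
Proof. by []. Qed.

Lemma Fcdf_ge0 u a : 0 <= F u a.
Proof.
by rewrite /Fcdf divr_ge0// fine_ge0//; apply: integral_ge0 => v _;
  rewrite lee_fin mulr_ge0 ?path_prob_ge0 ?scaled_chi_density_ge0 ?vnorm_gt0.
Qed.

Lemma Fcdf_le1 u x : F u (A x) <= 1.
Proof.
rewrite FcdfE; have := fine_ge0 (ray_int_ge0 +oo%O x).
rewrite le_eqVlt => /predU1P[<-|D0]; first by rewrite invr0 mulr0.
rewrite ler_pdivrMr// mul1r.
by apply: fine_le; [exact: ray_int_fin|exact: ray_int_fin|exact: ray_int_le].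
Qed.

(** A vanishing denominator forces a vanishing numerator by monotonicity, so the identity survives
    the convention for division by 0. *)
Lemma ray_int_Fcdf u x :
  ray_int (BRight u) x = ((F u (A x))%:E * ray_int +oo%O x)%E.
Proof.
have [D0|D0] := eqVneq (fine (ray_int +oo%O x)) 0.
  have Dx : ray_int +oo%O x = 0%E by rewrite -(fineK (ray_int_fin _ _)) D0.
  rewrite Dx mule0; apply/eqP; rewrite eq_le ray_int_ge0 andbT -Dx.
  exact: ray_int_le.
rewrite -(fineK (ray_int_fin (BRight u) x)) -(fineK (ray_int_fin +oo%O x)).
by rewrite -EFinM FcdfE divfK.
Qed.

Lemma measurable_Fcdf u : measurable_fun setT (fun t => F u (A (tup2mx t))).
Proof.
have mfine b : measurable_fun setT (fun t => fine (ray_int b (tup2mx t))).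
  by apply: measurableT_comp (measurable_ray_int b); exact: fine_measurable.
exact: (measurable_fun_div (mfine (BRight u)) (mfine +oo%O)).
Qed.

Hypothesis p0 : (0 < p)%N.
Hypothesis Shu : Sh \in unitmx.
Hypothesis ShT : Sh^T = Sh.
Hypothesis ShSh : Sh *m Sh = Sigma.
Hypothesis H0 : clmean mu C1 = clmean mu C2.

(** Substitution [v = U x * s] on the ray, where [A] is constant. The weight [k] and the bound [b]
    are left free so as to cover both [\1_B] with [U <= u] and [\1_B * F] with no bound on [U]. *)
Lemma integral_dil_density (k : 'rV[R]_p * 'M[R]_(n, p) -> R) b x :
  (forall a, 0 <= k a) -> 0 < U x ->
  (\int[leb]_s ((s^-1 * pos s * s ^+ p)%:E *
     (mn_density mu Sigma (dil nu s x) * q (dil nu s x) * k (A (dil nu s x)) *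
      \1_([set` Interval -oo%O b] : set R) (U (dil nu s x)))%:E) =
  (ray_mass mu Sigma Sh C1 C2 x * k (A x) / U x)%:E * ray_int b x)%E.
Proof.
move=> k0 U0; set K := ray_mass _ _ _ _ _ _.
have KE s : (s^-1 * pos s * s ^+ p) *
     (mn_density mu Sigma (dil nu s x) * q (dil nu s x) * k (A (dil nu s x)) *
      \1_([set` Interval -oo%O b] : set R) (U (dil nu s x))) =
   K * k (A x) * (ray_density x (U x * s) *
     \1_([set` Interval (BRight 0%R) b] : set R) (U x * s)).
  have [s0|s0] := ltP 0 s; last first.
    rewrite posE ltNge s0/= mulr0 !mul0r indicE memNset ?mulr0//=.
    by rewrite in_itv/= pmulr_rgt0// ltNge s0.
  rewrite Astat_dil// Ustat_dil// posE s0 mulr1.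
  have -> : \1_([set` Interval -oo%O b] : set R) (s * U x) =
            \1_([set` Interval (BRight 0%R) b] : set R) (U x * s) :> R.
    rewrite !indicE [s * _]mulrC; congr ((nat_of_bool _)%:R).
    by apply/idP/idP; rewrite !inE/= !in_itv/= pmulr_rgt0// s0.
  have := mn_density_dil p0 nu0 Shu ShT ShSh H0 s0 U0.
  rewrite -/K /ray_density [U x * s]mulrC Xu_Astat// => E.
  set J := \1_(_) _.
  transitivity ((s^-1 * s ^+ p * mn_density mu Sigma (dil nu s x)) *
    (q (dil nu s x) * k (A x) * J)); first by ring.
  by rewrite E; ring.
under eq_integral do rewrite -EFinM KE.
have K0 : 0 <= K.
  rewrite /K /ray_mass mulr_ge0 ?mulr_ge0 ?vnorm_ge0 ?mn_density_ge0//.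
    by rewrite exprn_ge0// divr_ge0 ?vnorm_ge0// ltW.
  exact/ltW/chi_const_gt0.
have mG : measurable_fun setT (fun v => (ray_density x v *
    \1_([set` Interval (BRight 0%R) b] : set R) v)%:E).
  apply/measurable_EFinP; apply: measurable_funM => //.
  by apply: (measurable_ray_density (x := cst x)) => //; exact: measurable_mx_cst.
have G0 v : (0 <= (ray_density x v *
    \1_([set` Interval (BRight 0%R) b] : set R) v)%:E)%E.
  by rewrite lee_fin mulr_ge0// ray_density_ge0.
(* [ray_int] includes the endpoint 0 while dilations reach only [v > 0]; a single point is
   negligible. *)
have -> : ray_int b x = (\int[leb]_v (ray_density x v *
    \1_([set` Interval (BRight 0%R) b] : set R) v)%:E)%E.
  rewrite /ray_int -integral_itv_obnd_cbnd; last exact: measurable_ray_density_r.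
  by rewrite integral_mkcond epatch_indic; under eq_integral do rewrite /= -EFinM.
rewrite (ge0_integral_affine 0 U0)// muleA -EFinM divfK ?gt_eqF//.
rewrite -ge0_integralZl//.
- by apply: eq_integral => s _; rewrite addr0 EFinM.
- apply: measurableT_comp mG _.
  by apply: measurable_funD => //; exact: measurable_funM.
- by rewrite lee_fin mulr_ge0.
Qed.

End RayIntegrals.

(** * Layer-cake formula *)

Section LayerCake.
Context {R : realType} d (T : measurableType d).
Local Notation leb := (@lebesgue_measure R).

(** Tonelli applied to [h x], written as the length of []0, h x[]. It serves for both [P] and the
    measure behind [iint], so that integrals of functions can be compared level by level. *)
Lemma weighted_layer_cake (m : {sigma_finite_measure set T -> \bar R}) (w h : T -> R) :
  measurable_fun setT w -> measurable_fun setT h ->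
  (forall x, 0 <= w x) -> (forall x, 0 <= h x) ->
  (\int[m]_x (w x * h x)%:E =
   \int[leb]_y \int[m]_x (w x * ((0 < y) && (y < h x))%:R)%:E)%E.
Proof.
move=> mw mh w0 h0.
pose PT := (measurableTypeR R * T)%type.
pose G (z : PT) := (w z.2 * ((0 < z.1) && (z.1 < h z.2))%:R)%:E.
have mG : measurable_fun setT G.
  apply/measurable_EFinP; apply: measurable_funM; first exact: measurableT_comp.
  rewrite (_ : (fun z : PT => _) =
    fun z : PT => if (0 < z.1) && (z.1 < h z.2) then 1 else 0 : R); last first.
    by apply/funext => z; case: ifP.
  apply: measurable_fun_ifT => //; apply: measurable_and.
    by apply: measurable_fun_ltr => //; exact: measurable_fst.
  apply: measurable_fun_ltr; first exact: measurable_fst.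
  exact: measurableT_comp.
have G0 z : (0 <= G z)%E by rewrite lee_fin mulr_ge0.
rewrite (fubini_tonelli (m1 := leb) (m2 := m) _ mG G0).
apply: eq_integral => x _.
rewrite (_ : (fun y => G (y, x)) =
    (fun y => (w x)%:E * (\1_(`]0%R, h x[%classic : set R) y)%:E)%E); last first.
  apply/funext => y; rewrite /G/= EFinM indicE; congr (_ * (nat_of_bool _)%:R%:E)%E.
  by apply/idP/idP; rewrite inE/= in_itv.
rewrite ge0_integralZl//; last 2 first.
- exact/measurable_EFinP.
- by rewrite lee_fin.
rewrite integral_indic// setIT/= lebesgue_measure_itv/= lte_fin EFinM.
congr (_ * _)%E; case: ltP => [_|]; first by rewrite sube0.
by move=> hx; congr EFin; apply: le_anti; rewrite hx h0.
Qed.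

End LayerCake.

Lemma posdef_unitmx {R : realType} (p : nat) (S : 'M[R]_p) :
  (forall v : 'rV[R]_p, v != 0 -> 0 < (v *m S *m v^T) 0 0) -> S \in unitmx.
Proof.
move=> Spos; rewrite -row_free_unit -kermx_eq0; apply/negPn/negP => /rowV0Pn[v].
move=> /sub_kermxP vS v0; have := Spos v v0.
by rewrite vS mul0mx mxE ltxx.
Qed.

(** * From the joint law of data and merges to the conditional law *)

Section ConditionalLaw.
Context {R : realType} (n p : nat) dO (Omega : measurableType dO).
Variable P : probability Omega R.
Variables (mu : 'M[R]_(n, p)) (Sigma Sh : 'M[R]_p) (C1 C2 : {set 'I_n}).
Variables (d : {set {set 'I_n}} -> 'M[R]_(n, p) -> R) (tau : R).
Variables (X : Omega -> 'M[R]_(n, p)) (M : Omega -> seq {set {set 'I_n}}).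
Variable ms : seq {set {set 'I_n}}.
Local Notation nu := (nuvec R C1 C2).
Local Notation leb := (@lebesgue_measure R).
Local Notation U := (Ustat Sh C1 C2).
Local Notation A := (Astat Sh C1 C2).
Local Notation f := (mn_density mu Sigma).
Local Notation q := (path_prob d tau ms).
Local Notation F := (Fcdf d tau Sh C1 C2 ms).
Local Notation pos := (\1_(`]0%R, +oo[%classic : set R) : R -> R).
Hypothesis md : forall M, mx_measurable_fun (d M).
Hypothesis nu0 : nu != 0.
Hypothesis p0 : (0 < p)%N.
Hypothesis Shu : Sh \in unitmx.
Hypothesis ShT : Sh^T = Sh.
Hypothesis ShSh : Sh *m Sh = Sigma.
Hypothesis H0 : clmean mu C1 = clmean mu C2.
Hypothesis mlaw : forall E : set 'M[R]_(n, p), mx_measurable E ->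
  measurable [set w | E (X w) /\ M w = ms].
Hypothesis law : forall E : set 'M[R]_(n, p), mx_measurable E ->
  P [set w | E (X w) /\ M w = ms] = intX (fun x => (f x * \1_E x * q x)%:E).

Let mU : measurable_fun setT (fun t => U (tup2mx t)).
Proof. exact: measurable_Ustat (@measurable_mx_tup2mx R n p). Qed.

Let mf : measurable_fun setT (fun t => f (tup2mx t)).
Proof. exact: measurable_mn_density (@measurable_mx_tup2mx R n p) _ _. Qed.

Let mq : measurable_fun setT (fun t => q (tup2mx t)).
Proof. exact: measurable_path_prob. Qed.

Let f0 x : 0 <= f x. Proof. exact: mn_density_ge0. Qed.
Let q0 x : 0 <= q x. Proof. exact: path_prob_ge0. Qed.

Lemma mx_measurable_preimage (g : 'M[R]_(n, p) -> R) (Y : set R) :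
  measurable_fun setT (fun t => g (tup2mx t)) -> measurable Y ->
  mx_measurable (g @^-1` Y).
Proof.
by move=> mg mY; rewrite /mx_measurable -[X in measurable X]setTI; exact: mg.
Qed.

Lemma mx_measurable_indic (E : set 'M[R]_(n, p)) : mx_measurable E ->
  measurable_fun setT (fun t => \1_E (tup2mx t) : R).
Proof.
move=> mE; rewrite (_ : (fun t => _) = \1_(@tup2mx R n p @^-1` E)).
  exact: measurable_indic.
by apply/funext => t; rewrite !indicE; congr ((nat_of_bool _)%:R);
  apply/idP/idP; rewrite !inE.
Qed.

(* On [U = 0] the dilations are the identity, so the change of variables
   [intX_dil] with factor 2 multiplies the finite mass of this event by [2 ^ p]. *)
Lemma intX_Ustat_eq0 :
  intX (fun x => (f x * \1_(U @^-1` [set 0]) x * q x)%:E) = 0%E.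
Proof.
pose z x := (f x * \1_(U @^-1` [set 0]) x * q x)%:E.
have mU0 : mx_measurable (U @^-1` [set 0]) by exact: mx_measurable_preimage.
have z0 x : (0 <= z x)%E by rewrite lee_fin !mulr_ge0.
have mz : measurable_fun setT (fun t => z (tup2mx t)).
  apply/measurable_EFinP; apply: measurable_funM => //.
  by apply: measurable_funM => //; exact: mx_measurable_indic.
have zE : intX z = ((2 ^+ p)%:E * intX z)%E.
  rewrite {1}(intX_dil nu0 (ltr0n _ 2) mz z0); congr (_ * intX _)%E.
  apply/funext => x; have [Ux|Ux] := eqVneq (U x) 0.
    by rewrite (Ustat_eq0_dil Shu).
  rewrite /z !indicE !memNset ?mulr0 ?mul0r//=; first by apply/eqP.
  by rewrite Ustat_dil//; apply/eqP; rewrite mulf_neq0.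
have zfin : intX z \is a fin_num.
  by rewrite /z -(law mU0); apply: fin_num_measure; exact: mlaw.
have rE : fine (intX z) = 2 ^+ p * fine (intX z) by rewrite {1}zE fineM.
rewrite -/z -(fineK zfin); congr EFin; apply/eqP; move/eqP: rE; apply: contraTT => r0.
rewrite -subr_eq0 -[X in X - _]mul1r -mulrBl mulf_eq0 negb_or r0 andbT subr_eq0.
rewrite eq_sym gt_eqF//; apply: (@lt_le_trans _ _ (2 ^+ 1)); first by rewrite expr1 ltr1n.
by rewrite ler_eXn2l ?ltr1n.
Qed.

Lemma intX_Ustat_pos (H : 'M[R]_(n, p) -> R) :
  measurable_fun setT (fun t => H (tup2mx t)) -> (forall x, 0 <= H x) ->
  (forall x, H x <= f x * q x) ->
  intX (fun x => (H x)%:E) = intX (fun x => (pos (U x))%:E * (H x)%:E)%E.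
Proof.
move=> mH H_ge0 Hle; have [m mE] := @iint_measure R (n * p).
have z0 := intX_Ustat_eq0.
set z := (fun x => _) in z0.
have zge0 x : (0 <= z x)%E by rewrite lee_fin !mulr_ge0.
have mz : measurable_fun setT (fun t => z (tup2mx t)).
  apply/measurable_EFinP; apply: measurable_funM => //.
  apply: measurable_funM => //; apply: mx_measurable_indic.
  exact: mx_measurable_preimage.
have pos01 x : 0 <= pos x <= 1 by rewrite posE; case: ltP; rewrite ?lexx ?ler01.
have mpH : measurable_fun setT (fun t => (pos (U (tup2mx t)))%:E * (H (tup2mx t))%:E)%E.
  by apply: emeasurable_funM; apply/measurable_EFinP => //; exact: measurable_pos.
have pH0 x : (0 <= (pos (U x))%:E * (H x)%:E)%E.
  by rewrite mule_ge0// lee_fin; case/andP: (pos01 (U x)).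
have mHE : measurable_fun setT (fun t => (H (tup2mx t))%:E) by exact/measurable_EFinP.
have HE0 x : (0 <= (H x)%:E)%E by rewrite lee_fin.
apply: le_anti; apply/andP; split.
  (* Adding [z], whose integral is 0, restores the domination at points with [U = 0], where [pos]
     discards [H]. *)
  rewrite -[leRHS]adde0 -z0 /intX !mE//.
  rewrite -ge0_integralD//; apply: ge0_le_integral => //.
  - by apply: emeasurable_funD.
  move=> t _; rewrite -EFinM lee_fin posE.
  have [U0|U0] := ltP 0 (U (tup2mx t)).
    by rewrite mul1r lerDl !mulr_ge0.
  have UE : U (tup2mx t) = 0 by apply: le_anti; rewrite U0 Ustat_ge0.
  by rewrite mul0r add0r indicE mem_set//= mulr1.
rewrite /intX !mE//; apply: ge0_le_integral => //.
by move=> t _; rewrite -EFinM lee_fin ler_piMl.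
Qed.

Section Event.
Variable B : set ('rV[R]_p * 'M[R]_(n, p)).
Hypothesis mB : mx_measurable (A @^-1` B).
Variable u : R.

Let mBA : measurable_fun setT (fun t => \1_B (A (tup2mx t)) : R).
Proof. exact: mx_measurable_indic mB. Qed.

Let mF : measurable_fun setT (fun t => F u (A (tup2mx t))).
Proof. exact: measurable_Fcdf. Qed.

Lemma intX_disintegration :
  intX (fun x => (f x * q x * \1_B (A x) * \1_([set` `]-oo, u]] : set R) (U x))%:E) =
  intX (fun x => (f x * q x * (\1_B (A x) * F u (A x)))%:E).
Proof.
pose H1 x := f x * q x * \1_B (A x) * \1_([set` `]-oo, u]] : set R) (U x).
pose H2 x := f x * q x * (\1_B (A x) * F u (A x)).
have F01 x : 0 <= F u (A x) <= 1 by rewrite Fcdf_ge0//= Fcdf_le1.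
have ind1 T (S : set T) y : (\1_S y : R) <= 1 by rewrite indicE; case: (_ \in _).
have mH1 : measurable_fun setT (fun t => H1 (tup2mx t)).
  apply: measurable_funM; first by do 2 apply: measurable_funM => //.
  have mI : measurable_fun setT (\1_([set` `]-oo, u]] : set R) : R -> R).
    exact: measurable_indic.
  exact: measurableT_comp mI mU.
have mH2 : measurable_fun setT (fun t => H2 (tup2mx t)).
  by do 2 apply: measurable_funM => //.
have H10 x : 0 <= H1 x by rewrite /H1 !mulr_ge0.
have H20 x : 0 <= H2 x.
  case/andP: (F01 x) => Fge0 _; apply: mulr_ge0; first exact: mulr_ge0.
  exact: mulr_ge0.
rewrite (intX_Ustat_pos mH1)//; last first.
  move=> x; rewrite /H1 -mulrA; apply: ler_piMr; first exact: mulr_ge0.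
  by apply: mulr_ile1 => //; exact: ind1.
rewrite (intX_Ustat_pos mH2)//; last first.
  move=> x; case/andP: (F01 x) => F0 F1.
  rewrite /H2; apply: ler_piMr; first exact: mulr_ge0.
  by apply: mulr_ile1 => //; exact: ind1.
apply: (radial_comparison nu0 mU _ (H1 := EFin \o H1) (H2 := EFin \o H2)) => //.
- by move=> s x s0; rewrite Ustat_dil.
- exact/measurable_EFinP.
- exact/measurable_EFinP.
move=> x Ux /=.
have H1E := integral_dil_density tau ms md nu0 p0 Shu ShT ShSh H0 (k := \1_B) (BRight u)
  (x := x) _ Ux.
rewrite H1E//.
have kge0 a : 0 <= (\1_B a * F u a : R).
  by apply: mulr_ge0 => //; exact: Fcdf_ge0.
have H2E := integral_dil_density tau ms md nu0 p0 Shu ShT ShSh H0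
  (k := fun a => \1_B a * F u a) +oo%O (x := x) kge0 Ux.
(* The ray integral up to [u] is [F] times the full one, and this [F] is absorbed into the weight
   [k]. *)
rewrite (ray_int_Fcdf Sh tau ms md nu0 u x) muleA -EFinM mulrAC -[X in (X / _)%:E]mulrA.
rewrite -H2E; apply: eq_integral => s _; congr (_ * _%:E)%E.
by rewrite /H2 [X in _ * X = _]indicE mem_set/= ?mulr1.
Qed.

(** The law only evaluates events [E (X w) /\ M w = ms]. Slicing both integrals by levels [y]
    reduces the claim to the events with [E] given by [A] in [B] and [y < F]. *)
Lemma integral_Fcdf :
  (\int[P]_(w in [set w | B (A (X w)) /\ M w = ms]) (F u (A (X w)))%:E =
   intX (fun x => (f x * q x * (\1_B (A x) * F u (A x)))%:E))%E.
Proof.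
have [m mE] := @iint_measure R (n * p).
have F0 x : 0 <= F u (A x) by exact: Fcdf_ge0.
set D := [set w | _].
have mD : measurable D by exact: (mlaw mB).
pose h w := if w \in D then F u (A (X w)) else 0.
have h0 w : 0 <= h w by rewrite /h; case: ifP.
have mFY Y : measurable Y -> mx_measurable ((fun x => F u (A x)) @^-1` Y).
  exact: mx_measurable_preimage mF.
(* Preimages under [h] are assembled from the events supplied by [mlaw] and from the complement of
   [D], where [h] is 0. *)
have mh : measurable_fun setT h.
  move=> _ Y mY; rewrite setTI.
  rewrite (_ : h @^-1` Y =
    [set w | (A @^-1` B `&` (fun x => F u (A x)) @^-1` Y) (X w) /\ M w = ms] `|`
    (~` D `&` [set w | Y 0])).
    apply: measurableU.
      by apply: mlaw; apply: measurableI => //; exact: mFY.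
    apply: measurableI; first exact: measurableC.
    have [Y0|Y0] := pselect (Y 0).
      by rewrite (_ : [set _ | _] = setT)//; apply/seteqP; split.
    by rewrite (_ : [set _ | _] = set0)//; apply/seteqP; split.
  apply/seteqP; split => w /=; rewrite /h; case: ifPn.
  - by rewrite inE => -[Bw Mw] Yw; left; split.
  - by rewrite notin_setE => Dw Y0; right; split.
  - by rewrite inE => Dw [[[_ Yw] _]|[/(_ Dw)]].
  - by rewrite notin_setE => Dw [[[Bw _] Mw]|[_ //]]; case: Dw; split.
rewrite integral_mkcond.
rewrite (_ : (fun w => _) = (fun w => (1 * h w)%:E)); last first.
  by apply/funext => w; rewrite patchE mul1r /h; case: ifP.
rewrite (weighted_layer_cake P)//.
pose k t := f (tup2mx t) * q (tup2mx t) * \1_B (A (tup2mx t)).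
transitivity (\int[m]_t (k t * F u (A (tup2mx t)))%:E)%E; last first.
  rewrite /intX mE.
  - by apply: eq_integral => t _; rewrite /k -mulrA.
  - apply/measurable_EFinP.
    by do 2 apply: measurable_funM => //.
  - by move=> t; rewrite lee_fin; apply: mulr_ge0; apply: mulr_ge0.
rewrite (weighted_layer_cake m)//; last 2 first.
- by do 2 apply: measurable_funM => //.
- by move=> t; rewrite !mulr_ge0.
apply: eq_integral => y _.
pose E := A @^-1` B `&` (fun x => F u (A x)) @^-1` [set r | (0 < y) && (y < r)].
have mEy : mx_measurable E.
  apply: measurableI => //; apply: mFY.
  have [y0|y0] := ltP 0 y.
    rewrite (_ : [set _ | _] = `]y, +oo[%classic)//.
    by apply/seteqP; split => r /=; rewrite in_itv/= andbT.
  by rewrite (_ : [set _ | _] = set0)//; apply/seteqP; split.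
transitivity (P [set w | E (X w) /\ M w = ms]).
  rewrite -[X in P X]setIT -integral_indic//; last exact: mlaw.
  apply: eq_integral => w _; rewrite mul1r indicE; congr ((nat_of_bool _)%:R%:E).
  rewrite /h; apply/idP/idP.
    case: ifPn => [|_ /andP[y0 /(lt_trans y0)]]; last by rewrite ltxx.
    by rewrite !inE => -[Bw Mw] yF; split.
  rewrite inE => -[[Bw yF] Mw]; rewrite ifT//.
  by rewrite inE; split.
have kE t : k t * ((0 < y) && (y < F u (A (tup2mx t))))%:R =
    f (tup2mx t) * \1_E (tup2mx t) * q (tup2mx t).
  have -> : \1_E (tup2mx t) =
      \1_B (A (tup2mx t)) * ((0 < y) && (y < F u (A (tup2mx t))))%:R :> R.
    rewrite !indicE -natrM mulnb; congr ((nat_of_bool _)%:R); apply/idP/idP.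
      by rewrite inE => -[Bx yF]; rewrite mem_set.
    by move=> /andP[]; rewrite inE => Bx yF; rewrite inE.
  rewrite /k; ring.
rewrite law// /intX mE.
- by apply: eq_integral => t _; rewrite kE.
- apply/measurable_EFinP; apply: measurable_funM => //.
  by apply: measurable_funM => //; exact: mx_measurable_indic.
- by move=> t; rewrite lee_fin !mulr_ge0.
Qed.

End Event.
End ConditionalLaw.

Theorem theorem4 (R : realType) (n p : nat)
    (dO : measure_display) (Omega : measurableType dO) (P : probability Omega R)
    (mu : 'M[R]_(n, p)) (Sigma Sh : 'M[R]_p)
    (d : {set {set 'I_n}} -> 'M[R]_(n, p) -> R) (tau : R)
    (X : Omega -> 'M[R]_(n, p)) (M : Omega -> seq {set {set 'I_n}})
    (m : seq {set {set 'I_n}}) (C1 C2 : {set 'I_n}) :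
  (0 < p)%N ->
  (* Sigma known, symmetric positive definite; Sh = Sigma^{1/2} *)
  Sigma^T = Sigma ->
  (forall v : 'rV[R]_p, v != 0 -> 0 < (v *m Sigma *m v^T) 0 0) ->
  Sh^T = Sh ->
  (forall v : 'rV[R]_p, v != 0 -> 0 < (v *m Sh *m v^T) 0 0) ->
  Sh *m Sh = Sigma ->
  (* linkage dissimilarity and temperature *)
  (forall (Mg : {set {set 'I_n}}) (x : 'M[R]_(n, p)), 0 <= d Mg x) ->
  (forall Mg : {set {set 'I_n}}, mx_measurable_fun (d Mg)) ->
  0 < tau ->
  (* joint law of the data X ~ MN(mu, I_n, Sigma) and of the first
     t = size m merges of the randomized algorithm run on X *)
  (forall (E : set 'M[R]_(n, p)) (ms : seq {set {set 'I_n}}),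
      size ms = size m -> mx_measurable E ->
      measurable [set w | E (X w) /\ M w = ms] /\
      P [set w | E (X w) /\ M w = ms] =
        intX (fun x => (mn_density mu Sigma x * \1_E x * path_prob d tau ms x)%:E)) ->
  (* m is a possible realization of the first t merges, m^(t) = (C1, C2) *)
  (0 < size m)%N -> valid_merges m ->
  last (@finset.set0 _) m = [set C1; C2]%SET -> C1 != C2 ->
  (* null hypothesis H_0^(t) *)
  clmean mu C1 = clmean mu C2 ->
  (* conclusion: Fcdf (. ; A, m) is the conditional CDF of U given (A_Sigma, M) *)
  forall B : set ('rV[R]_p * 'M[R]_(n, p)),
    mx_measurable (Astat Sh C1 C2 @^-1` B) ->
  forall u : R,
    P [set w | Ustat Sh C1 C2 (X w) <= u /\ B (Astat Sh C1 C2 (X w)) /\ M w = m] =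
    (\int[P]_(w in [set w | B (Astat Sh C1 C2 (X w)) /\ M w = m])
       (Fcdf d tau Sh C1 C2 m u (Astat Sh C1 C2 (X w)))%:E)%E.
Proof.
move=> p0 _ _ ShT Shpos ShSh _ md _ law _ _ _ C12 H0 B mB u.
have nu0 : nuvec R C1 C2 != 0 by exact: nuvec_neq0.
have Shu := posdef_unitmx Shpos.
have mlaw E mE := proj1 (law E m erefl mE).
have lawE E mE := proj2 (law E m erefl mE).
rewrite (integral_Fcdf md nu0 mlaw lawE mB u).
rewrite -(intX_disintegration md nu0 p0 Shu ShT ShSh H0 mlaw lawE mB u).
(* The right side is by now an [intX] with the indicator of [U <= u] in place of [F]; the law
   applied to [E] gives the same integral on the left. *)
pose E := (Ustat Sh C1 C2 @^-1` [set` `]-oo, u]]) `&` (Astat Sh C1 C2 @^-1` B).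
have mE : mx_measurable E.
  apply: measurableI => //; apply: mx_measurable_preimage => //.
  exact: measurable_Ustat (@measurable_mx_tup2mx R n p).
rewrite (_ : [set w | _] = [set w | E (X w) /\ M w = m]); last first.
  apply/seteqP; split => w; rewrite /E/= in_itv/=.
    by move=> [Uu [Bw Mw]]; split.
  by move=> [[Uu Bw] Mw]; split.
rewrite lawE//; congr intX; apply/funext => x; congr EFin.
have -> : \1_E x = \1_B (Astat Sh C1 C2 x) *
    \1_([set` `]-oo, u]] : set R) (Ustat Sh C1 C2 x) :> R.
  rewrite !indicE -natrM mulnb andbC; congr ((nat_of_bool _)%:R); apply/idP/idP.
    by rewrite inE => -[Ux Bx]; rewrite !mem_set.
  by move=> /andP[]; rewrite !inE => Ux Bx; split.
ring.
Qed.
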